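(* Let $C_1$ and $C_2$ be two coaxial circles in Lorentz-Minkowski space $\mathbb{R}_1^3$. (1) The number of catenoids connecting $C_1$ and $C_2$ is $0$ or $1$ in each of the following cases: spacelike elliptic catenoids; timelike hyperbolic catenoids of type II; parabolic catenoids. (2) The number of timelike hyperbolic catenoids of type I connecting $C_1$ and $C_2$ is $0$, $1$ or $2$. (3) For timelike elliptic catenoids (with $C_1,C_2$ circles about a timelike axis), and for spacelike hyperbolic catenoids of type II (with $C_1,C_2$ spacelike hyperbolas about a spacelike axis), if $C_1$ and $C_2$ have the same radius, then the number of such catenoids connecting $C_1$ and $C_2$ is a number $N(h)\geq 1$ depending on the distance $h>0$ between the circles, where (the common radius being fixed) $N(h)$ is non-decreasing in $h$ and $\lim_{h\to\infty}N(h)=\infty$.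
   Context: $\mathbb{R}_1^3$ is $\mathbb{R}^3$ with canonical basis $e_1,e_2,e_3$ and metric $\langle\cdot,\cdot\rangle=dx^2+dy^2-dz^2$. A vector $v$ is spacelike if $\langle v,v\rangle>0$ or $v=0$, timelike if $\langle v,v\rangle<0$, and lightlike if $\langle v,v\rangle=0$ and $v\neq0$. An immersed surface is spacelike (resp. timelike) if its induced metric is Riemannian (resp. Lorentzian), and non-degenerate if it is one of the two. Rotations. Up to an isometry of $\mathbb{R}_1^3$, the one-parameter groups $\{A(t):t\in\mathbb{R}\}$ of isometries leaving a line $L$ (the axis) pointwise fixed are: - elliptic ($L=\mathrm{span}\{e_3\}$, timelike): $A(t)(x,y,z)=(x\cos t-y\sin t,\;x\sin t+y\cos t,\;z)$; - hyperbolic ($L=\mathrm{span}\{e_1\}$, spacelike): $A(t)(x,y,z)=(x,\;y\cosh t+z\sinh t,\;y\sinh t+z\cosh t)$; - parabolic ($L=\mathrm{span}\{e_1+e_3\}$, lightlike): $A(t)(x,y,z)=\big((1-\tfrac{t^2}{2})x+ty+\tfrac{t^2}{2}z,\;-tx+y+tz,\;-\tfrac{t^2}{2}x+ty+(1+\tfrac{t^2}{2})z\big)$. Circles. A circle is the orbit of a point under an elliptic, hyperbolic or parabolic group of rotations, when the orbit is not a straight line (in particular the point is not on $L$). For $L=\mathrm{span}\{e_3\}$ the circles are $\{(r\cos t,r\sin t,c):t\in\mathbb{R}\}$ with $r>0$, $r$ being the radius. For $L=\mathrm{span}\{e_1\}$ the circles are the timelike hyperbolas (type I) $\{(p,c\cosh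 t,c\sinh t):t\in\mathbb{R}\}$ and the spacelike hyperbolas (type II) $\{(p,c\sinh t,c\cosh t):t\in\mathbb{R}\}$, with $c\neq0$ and radius $|c|$. For $L=\mathrm{span}\{e_1+e_3\}$ they are the parabolas that are orbits of points $(a,0,c)$ with $a\neq c$, lying in planes $x-z=\text{const}$; no radius is defined for these. Two circles are coaxial if they lie in different planes and are invariant by the same group of rotations. The distance between two coaxial circles with timelike or spacelike axis is the distance between the parallel planes containing them ($z=\text{const}$, resp. $x=\text{const}$). In part (3), for hyperbolas of type II, when $h$ varies with fixed radius the sign of $z$ on each of $C_1,C_2$ is kept fixed. Catenoids. A catenoid is a non-degenerate rotational surface (invariant by an elliptic, hyperbolic or parabolic group of rotations) with zero mean curvature everywhere. Up to an isometry, with axis $L=\mathrm{span}\{e_3\}$ in the elliptic case, $L=\mathrm{span}\{e_1\}$ in the hyperbolic case and $L=\mathrm{span}\{e_1+e_3\}$ in the parabolic case, the catenoids are the following surfaces, $s,t\in\mathbb{R}$, $b\in\mathbb{R}$: - elliptic, $(f(s)\cos t,f(s)\sin t,s)$: spacelike for $f(s)=\frac1a\sinh(as+b)$, timelike for $f(s)=\frac1a\sin(as+b)$, $a\neq0$; - hyperbolic of type I, $(s,f(s)\cosh t,f(s)\sinh t)$: timelike for $f(s)=\frac1a\cosh(as+b)$, $a\neq0$ (there are no spacelike ones); - hyperbolic of type II, $(s,f(s)\sinh t,f(s)\cosh t)$: spacelike for $f(s)=\frac1a\sin(as+b)$, timelike for $f(s)=\frac1a\sinh(as+b)$, $a\neq0$;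 - parabolic, $A(t)\cdot(f(s)+s,0,f(s)-s)$ with $A(t)$ the parabolic rotations: spacelike for $f(s)=as^3+b$, timelike for $f(s)=-as^3+b$, $a>0$. The profile curve is taken over all $s\in\mathbb{R}$ and is allowed to meet the rotation axis (where the surface has a singularity). A catenoid connects (spans) two coaxial circles if it is a catenoid with respect to the same group of rotations and contains both circles; catenoids are counted as distinct when they are distinct subsets of $\mathbb{R}_1^3$.
   Formalization: For spacelike elliptic catenoids, those counted have a profile curve through given points of C1 and C2 (two catenoids can contain both circles when |r1-r2|>h); for hyperbolas of opposite z-sign, N(h)≥1 is claimed only for h greater than twice the radius, as N(h)=0 otherwise. *)

(* Defs.v *)
From Stdlib Require Import Reals List.
From Coquelicot Require Import Coquelicot.
Open Scope R_scope.

Definition point : Type := (R * R * R)%type.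
Definition pset : Type := point -> Prop.

Definition cx (p : point) : R := fst (fst p).
Definition cy (p : point) : R := snd (fst p).
Definition cz (p : point) : R := snd p.

Definition padd (p q : point) : point := (cx p + cx q, cy p + cy q, cz p + cz q).
Definition psub (p q : point) : point := (cx p - cx q, cy p - cy q, cz p - cz q).
Definition pscale (a : R) (p : point) : point := (a * cx p, a * cy p, a * cz p).

Definition lor (p q : point) : R := cx p * cx q + cy p * cy q - cz p * cz q.

(* The Lorentzian vector product: lor (lcross u v) w = det (u, v, w). *)
Definition lcross (u v : point) : point :=
  (cy u * cz v - cz u * cy v, cz u * cx v - cx u * cz v, cy u * cx v - cx u * cy v).

(* Maps of this kind are exactly the affine maps with linear part in O(2,1);
   in particular they are bijective. *)
Definition isometry (phi : point -> point) : Prop :=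
  forall p q, lor (psub (phi p) (phi q)) (psub (phi p) (phi q))
              = lor (psub p q) (psub p q).

Inductive axis : Type := Elliptic | Hyperbolic | Parabolic.

Definition rot (k : axis) (t : R) (p : point) : point :=
  let '(x, y, z) := p in
  match k with
  | Elliptic => (x * cos t - y * sin t, x * sin t + y * cos t, z)
  | Hyperbolic => (x, y * cosh t + z * sinh t, y * sinh t + z * cosh t)
  | Parabolic => ((1 - t ^ 2 / 2) * x + t * y + t ^ 2 / 2 * z,
                  - t * x + y + t * z,
                  - (t ^ 2 / 2) * x + t * y + (1 + t ^ 2 / 2) * z)
  end.

(* [frame k G phi]: the set of maps G is the group of rotations
   { phi o rot k t o phi^-1 : t in R }. *)
Definition frame (k : axis) (G : (point -> point) -> Prop) (phi : point -> point) : Prop :=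
  isometry phi /\
  forall g, G g <-> exists t, forall p, g (phi p) = phi (rot k t p).

Definition rotation_group (G : (point -> point) -> Prop) : Prop :=
  exists k phi, frame k G phi.

Definition in_line (A : pset) : Prop :=
  exists q v, forall p, A p -> exists a, p = padd q (pscale a v).

Definition in_plane (A : pset) : Prop :=
  exists n d, n <> (0, 0, 0) /\
    forall p, A p -> cx n * cx p + cy n * cy p + cz n * cz p = d.

Definition image (phi : point -> point) (A : pset) : pset :=
  fun q => exists p, A p /\ q = phi p.

Definition incl (A B : pset) : Prop := forall p, A p -> B p.

(* [in_line] rather than "is a line": besides lines, the degenerate orbits are
   single points and, for a hyperbolic group, open lightlike half-lines. *)
Definition circle (G : (point -> point) -> Prop) (C : pset) : Prop :=
  (exists p, forall q, C q <-> exists g, G g /\ q = g p) /\ ~ in_line C.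

(* A circle spans a plane, so two circles lie in different planes exactly when
   no plane contains both. *)
Definition coaxial (G : (point -> point) -> Prop) (C1 C2 : pset) : Prop :=
  circle G C1 /\ circle G C2 /\ ~ in_plane (fun p => C1 p \/ C2 p).

Definition ecircle (r c : R) : pset :=
  fun p => exists t, p = (r * cos t, r * sin t, c).

Definition hyperbola2 (c m : R) : pset :=
  fun p => exists t, p = (m, c * sinh t, c * cosh t).

Definition dvec (c : R -> point) (u : R) : point :=
  (Derive (fun v => cx (c v)) u, Derive (fun v => cy (c v)) u,
   Derive (fun v => cz (c v)) u).

Section Patch.
Variable X : R -> R -> point.

Definition Xs (s t : R) : point := dvec (fun u => X u t) s.
Definition Xt (s t : R) : point := dvec (fun v => X s v) t.
Definition Xss (s t : R) : point := dvec (fun u => Xs u t) s.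
Definition Xst (s t : R) : point := dvec (fun v => Xs s v) t.
Definition Xtt (s t : R) : point := dvec (fun v => Xt s v) t.

Definition ffE (s t : R) : R := lor (Xs s t) (Xs s t).
Definition ffF (s t : R) : R := lor (Xs s t) (Xt s t).
Definition ffG (s t : R) : R := lor (Xt s t) (Xt s t).
Definition ffW (s t : R) : R := ffE s t * ffG s t - ffF s t ^ 2.

Definition unit_normal (s t : R) : point :=
  pscale (/ sqrt (Rabs (ffW s t))) (lcross (Xs s t) (Xt s t)).

Definition mean_curvature (s t : R) : R :=
  let n := unit_normal s t in
  lor n n *
  (lor n (Xss s t) * ffG s t - 2 * lor n (Xst s t) * ffF s t
   + lor n (Xtt s t) * ffE s t) / (2 * ffW s t).
End Patch.

Inductive causal : Type := Spacelike | Timelike.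

Definition induced_metric (c : causal) (X : R -> R -> point) (s t : R) : Prop :=
  match c with
  | Spacelike => 0 < ffE X s t /\ 0 < ffW X s t
  | Timelike => ffW X s t < 0
  end.

Inductive rkind : Type := Ell | HypI | HypII | Par.

Definition axis_of (k : rkind) : axis :=
  match k with Ell => Elliptic | HypI | HypII => Hyperbolic | Par => Parabolic end.

Definition profile (k : rkind) (f : R -> R) (s : R) : point :=
  match k with
  | Ell => (f s, 0, s)
  | HypI => (s, f s, 0)
  | HypII => (s, 0, f s)
  | Par => (f s + s, 0, f s - s)
  end.

Definition on_axis (k : axis) (p : point) : Prop := forall t, rot k t p = p.

(* Profiles of catenoids of causal type c: smooth on the whole of R, the
   rotational surface being non-degenerate of type c with zero mean curvature
   wherever the profile does not meet the axis. The profile may meet the axis,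
   but may not be contained in it.  The solutions are
     Ell, HypII: f s = sinh (a s + b) / a or - sinh (a s + b) / a
                 (spacelike for Ell, timelike for HypII),
                 f s = sin (a s + b) / a (timelike, resp. spacelike);
     HypI:       f s = cosh (a s + b) / a (timelike);
     Par:        f s = a s^3 + b, spacelike for a > 0, timelike for a < 0,
   with a <> 0. *)
Definition catenary (c : causal) (k : rkind) (f : R -> R) : Prop :=
  let X s t := rot (axis_of k) t (profile k f s) in
  (forall n s, ex_derive_n f n s) /\
  (exists s, ~ on_axis (axis_of k) (profile k f s)) /\
  (forall s t, ~ on_axis (axis_of k) (profile k f s) ->
     induced_metric c X s t /\ mean_curvature X s t = 0).

Definition generates (c : causal) (k : rkind) (G : (point -> point) -> Prop)
    (phi : point -> point) (f : R -> R) (S : pset) : Prop :=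
  frame (axis_of k) G phi /\ catenary c k f /\
  forall p, S p <-> exists s t, p = phi (rot (axis_of k) t (profile k f s)).

Definition catenoid (c : causal) (k : rkind) (G : (point -> point) -> Prop)
    (S : pset) : Prop :=
  exists phi f, generates c k G phi f S.

Definition connects (c : causal) (k : rkind) (G : (point -> point) -> Prop)
    (C1 C2 S : pset) : Prop :=
  catenoid c k G S /\ incl C1 S /\ incl C2 S.

(* The catenoid has a profile curve (generating meridian) through p1 and p2.
   For elliptic groups this is finer than containing the circles of p1 and p2:
   a rotation by PI reverses the sign of the profile, so the surface may contain
   two circles with their points in a meridian half-plane lying on opposite
   profile curves f and - f. *)
Definition connects_points (c : causal) (k : rkind) (G : (point -> point) -> Prop)
    (p1 p2 : point) (S : pset) : Prop :=
  exists phi f, generates c k G phi f S /\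
    (exists s, p1 = phi (profile k f s)) /\ (exists s, p2 = phi (profile k f s)).

Definition number (A : pset -> Prop) (n : nat) : Prop :=
  exists l : list pset, NoDup l /\ length l = n /\ forall S, In S l <-> A S.

(* Main.v *)
Require Import Defs.
From Stdlib Require Import Reals ZArith List Lra Lia Psatz.
From Stdlib Require Import FunctionalExtensionality PropExtensionality ClassicalEpsilon Classical.
From Coquelicot Require Import Coquelicot.
Open Scope R_scope.

(* An isometry conjugating a rotation group to itself moves a profile curve to a
   rotated profile curve, reparametrized affinely; hence all catenoids of a group G can be
   written in one frame. Zero mean curvature of a non-parabolic rotational surface means
   f f'' = f'^2 + e, e = 1 or -1, whose smooth solutions satisfy f'' = K f and
   f'^2 + e = K f^2 also across the zeros of f.

   For (1) and (2), centre the profile at the midpoint of the two circles, at distance d from them.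
   For sinh profiles of parameter a, the half difference D and half sum M of the boundary values
   satisfy D^2 = (sinh (a d) / a)^2 + M^2 tanh (a d)^2, increasing in a; for cosh
   profiles, M^2 - D^2 = (cosh (a d) / a)^2 + D^2 / sinh (a d)^2, strictly convex in a.
   Parabolic profiles a s^3 + b are determined by two values.

   For (3), a sine profile is determined by its phases al < be at the two circles, which
   satisfy |sin al| = |sin be| = rho (be - al), with rho the ratio of the radius to the distance.
   So be = al + k PI or be = k PI - al, and each of these families splits
   into two branches carrying at most one solution each. A branch that carries a solution
   for rho carries one for every smaller rho, so the number of
   solutions is the number of a set of branches which grows as rho decreases. *)

Ltac coords := unfold lor, padd, psub, pscale, lcross, cx, cy, cz in *; cbn [fst snd] in *.

Lemma point_eq (p q : point) : cx p = cx q -> cy p = cy q -> cz p = cz q -> p = q.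
Proof. destruct p as [[a b] c], q as [[a' b'] c']; unfold cx, cy, cz; simpl; congruence. Qed.

Ltac pt := apply point_eq; unfold cx, cy, cz; cbn [fst snd].

Lemma pset_ext (A B : pset) : (forall p, A p <-> B p) -> A = B.
Proof.
  intros H; apply functional_extensionality; intros p.
  apply propositional_extensionality, H.
Qed.

(** * Isometries and frames *)

Definition lin (phi : point -> point) (p : point) : point := psub (phi p) (phi (0, 0, 0)).

Lemma lin_lor phi p q : isometry phi -> lor (lin phi p) (lin phi q) = lor p q.
Proof.
  intros H. pose proof (H p (0,0,0)) as Hp. pose proof (H q (0,0,0)) as Hq.
  pose proof (H p q) as Hpq. unfold lin.
  destruct (phi p) as [[a1 a2] a3], (phi q) as [[b1 b2] b3], (phi (0,0,0)) as [[c1 c2] c3].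
  destruct p as [[p1 p2] p3], q as [[q1 q2] q3]. coords. nra.
Qed.

Lemma orthonormal_nondegenerate u v w d :
  lor u u = 1 -> lor v v = 1 -> lor w w = -1 ->
  lor u v = 0 -> lor u w = 0 -> lor v w = 0 ->
  lor d u = 0 -> lor d v = 0 -> lor d w = 0 -> d = (0, 0, 0).
Proof.
  destruct u as [[u1 u2] u3], v as [[v1 v2] v3], w as [[w1 w2] w3], d as [[d1 d2] d3].
  coords; intros Huu Hvv Hww Huv Huw Hvw Hu Hv Hw.
  set (D := u1 * (v2 * w3 - v3 * w2) - u2 * (v1 * w3 - v3 * w1) + u3 * (v1 * w2 - v2 * w1)).
  assert (HD : D * D = 1).
  { assert (E : D * D = -((u1*u1+u2*u2-u3*u3) * ((v1*v1+v2*v2-v3*v3)*(w1*w1+w2*w2-w3*w3)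
        - (v1*w1+v2*w2-v3*w3)^2)
      - (u1*v1+u2*v2-u3*v3) * ((u1*v1+u2*v2-u3*v3)*(w1*w1+w2*w2-w3*w3)
         - (v1*w1+v2*w2-v3*w3)*(u1*w1+u2*w2-u3*w3))
      + (u1*w1+u2*w2-u3*w3) * ((u1*v1+u2*v2-u3*v3)*(v1*w1+v2*w2-v3*w3)
         - (v1*v1+v2*v2-v3*v3)*(u1*w1+u2*w2-u3*w3)))) by (unfold D; ring).
    rewrite E, Huu, Hvv, Hww, Huv, Huw, Hvw; ring. }
  assert (HD0 : D <> 0) by (intros E; rewrite E in HD; lra).
  assert (E1 : D * d1 = (d1*u1+d2*u2-d3*u3) * (v2*w3-v3*w2)
     - (d1*v1+d2*v2-d3*v3) * (u2*w3-u3*w2) + (d1*w1+d2*w2-d3*w3) * (u2*v3-u3*v2))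
    by (unfold D; ring).
  assert (E2 : D * d2 = - (d1*u1+d2*u2-d3*u3) * (v1*w3-v3*w1)
     + (d1*v1+d2*v2-d3*v3) * (u1*w3-u3*w1) - (d1*w1+d2*w2-d3*w3) * (u1*v3-u3*v1))
    by (unfold D; ring).
  assert (E3 : D * d3 = - (d1*u1+d2*u2-d3*u3) * (v1*w2-v2*w1)
     + (d1*v1+d2*v2-d3*v3) * (u1*w2-u2*w1) - (d1*w1+d2*w2-d3*w3) * (u1*v2-u2*v1))
    by (unfold D; ring).
  rewrite Hu, Hv, Hw in E1, E2, E3.
  f_equal; [f_equal|]; apply (Rmult_eq_reg_l D); trivial; [rewrite E1 | rewrite E2 | rewrite E3]; ring.
Qed.

Lemma isometry_nondegenerate phi d :
  isometry phi -> (forall p, lor d (lin phi p) = 0) -> d = (0, 0, 0).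
Proof.
  intros H Hd.
  apply (orthonormal_nondegenerate (lin phi (1,0,0)) (lin phi (0,1,0)) (lin phi (0,0,1)));
    try apply Hd; rewrite lin_lor by assumption; coords; ring.
Qed.

Lemma lin_add phi p q : isometry phi -> lin phi (padd p q) = padd (lin phi p) (lin phi q).
Proof.
  intros H.
  assert (E : psub (lin phi (padd p q)) (padd (lin phi p) (lin phi q)) = (0,0,0)).
  { apply (isometry_nondegenerate phi); trivial. intros r.
    assert (L : forall a b c, lor (psub a (padd b c)) (lin phi r)
       = lor a (lin phi r) - lor b (lin phi r) - lor c (lin phi r)) by (intros; coords; ring).
    rewrite L, !lin_lor by trivial. coords; ring. }
  apply point_eq; [apply (f_equal cx) in E | apply (f_equal cy) in E | apply (f_equal cz) in E];
    coords; lra.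
Qed.

Lemma lin_scale phi a p : isometry phi -> lin phi (pscale a p) = pscale a (lin phi p).
Proof.
  intros H.
  assert (E : psub (lin phi (pscale a p)) (pscale a (lin phi p)) = (0,0,0)).
  { apply (isometry_nondegenerate phi); trivial. intros r.
    assert (L : forall b c, lor (psub b (pscale a c)) (lin phi r)
       = lor b (lin phi r) - a * lor c (lin phi r)) by (intros; coords; ring).
    rewrite L, !lin_lor by trivial. coords; ring. }
  apply point_eq; [apply (f_equal cx) in E | apply (f_equal cy) in E | apply (f_equal cz) in E];
    coords; lra.
Qed.

Lemma isometry_comb phi a p b q : isometry phi ->
  phi (padd (pscale a p) (pscale b q))
  = padd (phi (0,0,0)) (padd (pscale a (lin phi p)) (pscale b (lin phi q))).
Proof.
  intros H. pose proof (lin_add phi (pscale a p) (pscale b q) H) as E.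
  rewrite !lin_scale in E by trivial. rewrite <- E. unfold lin.
  apply point_eq; coords; ring.
Qed.

Lemma isometry_inj phi p q : isometry phi -> phi p = phi q -> p = q.
Proof.
  intros H E.
  assert (Hl : forall r, lor (psub p q) r = 0).
  { intros r. assert (L : lor (psub p q) r = lor p r - lor q r) by (coords; ring).
    rewrite L, <- (lin_lor phi p r), <- (lin_lor phi q r) by trivial. unfold lin. rewrite E. ring. }
  pose proof (Hl (1,0,0)); pose proof (Hl (0,1,0)); pose proof (Hl (0,0,1)).
  apply point_eq; coords; lra.
Qed.

Definition inv (phi : point -> point) (q : point) : point :=
  let d := psub q (phi (0,0,0)) in
  (lor d (lin phi (1,0,0)), lor d (lin phi (0,1,0)), - lor d (lin phi (0,0,1))).

Lemma inv_r phi q : isometry phi -> phi (inv phi q) = q.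
Proof.
  intros H. set (d := psub q (phi (0,0,0))).
  assert (E : psub d (lin phi (inv phi q)) = (0,0,0)).
  { apply (orthonormal_nondegenerate (lin phi (1,0,0)) (lin phi (0,1,0)) (lin phi (0,0,1)));
    try (rewrite lin_lor by assumption; coords; ring);
    match goal with |- lor (psub ?a ?b) ?c = 0 =>
      assert (L : lor (psub a b) c = lor a c - lor b c) by (coords; ring);
      rewrite L, lin_lor by trivial; clear L; unfold inv; fold d;
      generalize (lor d (lin phi (1,0,0))), (lor d (lin phi (0,1,0))), (lor d (lin phi (0,0,1)));
      intros; coords; ring
    end. }
  unfold d, lin in E.
  apply point_eq; [apply (f_equal cx) in E | apply (f_equal cy) in E | apply (f_equal cz) in E];
    coords; lra.
Qed.

Lemma inv_l phi p : isometry phi -> inv phi (phi p) = p.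
Proof. intros H. apply (isometry_inj phi); trivial. apply inv_r, H. Qed.

Lemma inv_isometry phi psi : isometry phi -> isometry psi -> isometry (fun p => inv phi (psi p)).
Proof.
  intros H H' p q. rewrite <- H, !inv_r by trivial. apply H'.
Qed.

Lemma rot_add k a b p : rot k a (rot k b p) = rot k (a + b) p.
Proof.
  destruct p as [[x y] z]; destruct k; simpl; pt; trivial;
    try (rewrite ?cos_plus, ?sin_plus; ring); try field;
    unfold cosh, sinh; rewrite ?Ropp_plus_distr, ?exp_plus; field.
Qed.

Lemma rot_0 k p : rot k 0 p = p.
Proof.
  destruct p as [[x y] z]; destruct k; simpl; pt; trivial;
  rewrite ?cos_0, ?sin_0, ?cosh_0, ?sinh_0; field.
Qed.

Definition normalizes (k : axis) (psi : point -> point) : Prop :=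
  (forall t, exists t', forall p, psi (rot k t p) = rot k t' (psi p)) /\
  (forall t', exists t, forall p, psi (rot k t p) = rot k t' (psi p)).

Lemma frame_exists_element k G phi t :
  frame k G phi -> exists g, G g /\ forall p, g (phi p) = phi (rot k t p).
Proof.
  intros [Hi Hf]. exists (fun q => phi (rot k t (inv phi q))).
  assert (E : forall p, phi (rot k t (inv phi (phi p))) = phi (rot k t p))
    by (intros p; rewrite inv_l by trivial; reflexivity).
  split; trivial. apply Hf. exists t; trivial.
Qed.

Lemma frame_change k G phi phi' : frame k G phi -> frame k G phi' ->
  isometry (fun p => inv phi (phi' p)) /\ normalizes k (fun p => inv phi (phi' p)).
Proof.
  intros F F'. pose proof F as [Hi Hf]; pose proof F' as [Hi' Hf'].
  split; [apply inv_isometry; trivial|]. split.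
  - intros t. destruct (frame_exists_element k G phi' t F') as [g [Hg E]].
    apply Hf in Hg. destruct Hg as [t' Ht']. exists t'. intros p.
    rewrite <- E, <- (inv_r phi (phi' p)) by trivial.
    rewrite Ht', !inv_l by trivial. reflexivity.
  - intros t. destruct (frame_exists_element k G phi t F) as [g [Hg E]].
    apply Hf' in Hg. destruct Hg as [t' Ht']. exists t'. intros p.
    apply (isometry_inj phi); trivial.
    rewrite inv_r, <- E, inv_r by trivial. symmetry; apply Ht'.
Qed.

Lemma normalizes_on_axis k psi p : normalizes k psi -> on_axis k p -> on_axis k (psi p).
Proof.
  intros [_ H] Hp t. destruct (H t) as [t' Ht']. rewrite <- Ht', Hp. reflexivity.
Qed.

Lemma cosh_gt_1 x : x <> 0 -> 1 < cosh x.
Proof.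
  intros Hx. unfold cosh.
  assert (exp x * exp (-x) = 1) by (rewrite <- exp_plus, Rplus_opp_r; apply exp_0).
  assert (exp x <> 1) by (intros E; apply Hx, exp_inv; rewrite exp_0; trivial).
  pose proof (exp_pos x). pose proof (exp_pos (-x)).
  assert (0 < (exp x - 1)^2) by nra. nra.
Qed.

Lemma cosh_pos x : 0 < cosh x.
Proof. unfold cosh. pose proof (exp_pos x); pose proof (exp_pos (-x)); lra. Qed.

Lemma cosh2 x : cosh x ^ 2 = 1 + sinh x ^ 2.
Proof.
  assert (exp x * exp (-x) = 1) by (rewrite <- exp_plus, Rplus_opp_r; apply exp_0).
  unfold cosh, sinh. nra.
Qed.

Lemma cosh_neg x : cosh (- x) = cosh x.
Proof. unfold cosh. rewrite Ropp_involutive. lra. Qed.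
Lemma sinh_neg x : sinh (- x) = - sinh x.
Proof. unfold sinh. rewrite Ropp_involutive. lra. Qed.

Lemma on_axis_elliptic x y z : on_axis Elliptic (x, y, z) <-> x = 0 /\ y = 0.
Proof.
  split.
  - intros H. specialize (H PI). simpl in H. rewrite cos_PI, sin_PI in H.
    injection H; intros; lra.
  - intros [-> ->] t. simpl. pt; ring.
Qed.

Lemma on_axis_hyperbolic x y z : on_axis Hyperbolic (x, y, z) <-> y = 0 /\ z = 0.
Proof.
  split.
  - intros H. pose proof (H 1) as H1. pose proof (H (- (1))) as H2. simpl in H1, H2.
    rewrite cosh_neg, sinh_neg in H2.
    pose proof (cosh_gt_1 1 R1_neq_R0) as Hc.
    injection H1; injection H2; intros.
    assert (y * (cosh 1 - 1) = 0) by lra. assert (z * (cosh 1 - 1) = 0) by lra.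
    split; nra.
  - intros [-> ->] t. simpl. pt; ring.
Qed.

Lemma on_axis_parabolic x y z : on_axis Parabolic (x, y, z) <-> x = z /\ y = 0.
Proof.
  split.
  - intros H. pose proof (H 1) as H1. pose proof (H (-1)) as H2. simpl in H1, H2.
    injection H1; injection H2; intros; lra.
  - intros [-> ->] t. simpl. pt; field.
Qed.

Lemma circle_param x y : x ^ 2 + y ^ 2 = 1 -> exists t, x = cos t /\ y = sin t.
Proof.
  intros H.
  assert (Hx : -1 <= x <= 1) by nra.
  assert (Hs : Rabs y = sin (acos x)).
  { rewrite sin_acos by trivial. rewrite <- sqrt_Rsqr_abs. f_equal. unfold Rsqr; nra. }
  unfold Rabs in Hs. destruct (Rcase_abs y).
  - exists (- acos x). rewrite cos_neg, sin_neg, cos_acos by trivial. lra.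
  - exists (acos x). rewrite cos_acos by trivial. lra.
Qed.

Lemma sinh_surj y : exists t, sinh t = y.
Proof. exists (arcsinh y). apply sinh_arcsinh. Qed.

Lemma hyperbola_param x y : x ^ 2 - y ^ 2 = 1 ->
  exists eta t, eta ^ 2 = 1 /\ x = eta * cosh t /\ y = eta * sinh t.
Proof.
  intros H. destruct (Rle_lt_dec 0 x) as [h|h].
  - destruct (sinh_surj y) as [t Ht]. exists 1, t. repeat split; try lra.
    pose proof (cosh2 t). pose proof (cosh_pos t). nra.
  - destruct (sinh_surj (-y)) as [t Ht]. exists (-1), t. repeat split; try lra.
    pose proof (cosh2 t). pose proof (cosh_pos t). nra.
Qed.

Lemma profile_change k psi :
  k <> Par -> isometry psi -> normalizes (axis_of k) psi ->
  exists al eps o eta, eps ^ 2 = 1 /\ eta ^ 2 = 1 /\ forall f s,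
    psi (profile k f s)
    = rot (axis_of k) al (profile k (fun x => eta * f (eps * (x - o))) (eps * s + o)).
Proof.
  intros Hk Hi Hn.
  assert (Hax : forall p, on_axis (axis_of k) p -> on_axis (axis_of k) (psi p))
    by (intros p; apply normalizes_on_axis; trivial).
  pose proof (fun p q => lin_lor psi p q Hi) as Hl.
  assert (Hrev : forall eps s o, eps ^ 2 = 1 -> eps * (eps * s + o - o) = s)
    by (intros eps s o E; replace (eps * (eps * s + o - o)) with (eps ^ 2 * s) by ring;
        rewrite E; ring).
  destruct k; try congruence; simpl in Hax, Hn |- *.
  - assert (H0 : on_axis Elliptic (psi (0,0,0))) by (apply Hax, on_axis_elliptic; lra).
    assert (H3 : on_axis Elliptic (psi (0,0,1))) by (apply Hax, on_axis_elliptic; lra).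
    pose proof (Hl (0,0,1) (0,0,1)) as L33. pose proof (Hl (1,0,0) (1,0,0)) as L11.
    pose proof (Hl (1,0,0) (0,0,1)) as L13.
    assert (Hc : forall r s, psi (r, 0, s) = padd (psi (0,0,0))
      (padd (pscale r (lin psi (1,0,0))) (pscale s (lin psi (0,0,1))))).
    { intros r s. rewrite <- isometry_comb by trivial. f_equal. apply point_eq; coords; ring. }
    unfold lin in *.
    destruct (psi (0,0,0)) as [[o1 o2] o3], (psi (0,0,1)) as [[w1 w2] w3],
      (psi (1,0,0)) as [[u1 u2] u3].
    apply on_axis_elliptic in H0, H3. destruct H0 as [-> ->], H3 as [-> ->].
    coords.
    assert (Hw : (w3 - o3) ^ 2 = 1) by lra.
    assert (Hu3 : u3 = o3) by nra. subst u3.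
    destruct (circle_param u1 u2) as [al [-> ->]]; [nra|].
    exists al, (w3 - o3), o3, 1. repeat split; try lra. intros f s.
    rewrite Hrev, Hc by trivial. pt; ring.
  - assert (H0 : on_axis Hyperbolic (psi (0,0,0))) by (apply Hax, on_axis_hyperbolic; lra).
    assert (H3 : on_axis Hyperbolic (psi (1,0,0))) by (apply Hax, on_axis_hyperbolic; lra).
    pose proof (Hl (1,0,0) (1,0,0)) as L33. pose proof (Hl (0,1,0) (0,1,0)) as L11.
    pose proof (Hl (0,1,0) (1,0,0)) as L13.
    assert (Hc : forall r s, psi (s, r, 0) = padd (psi (0,0,0))
      (padd (pscale r (lin psi (0,1,0))) (pscale s (lin psi (1,0,0))))).
    { intros r s. rewrite <- isometry_comb by trivial. f_equal. apply point_eq; coords; ring. }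
    unfold lin in *.
    destruct (psi (0,0,0)) as [[o1 o2] o3], (psi (1,0,0)) as [[w1 w2] w3],
      (psi (0,1,0)) as [[u1 u2] u3].
    apply on_axis_hyperbolic in H0, H3. destruct H0 as [-> ->], H3 as [-> ->].
    coords.
    assert (Hw : (w1 - o1) ^ 2 = 1) by lra.
    assert (Hu3 : u1 = o1) by nra. subst u1.
    destruct (hyperbola_param u2 u3) as [eta [al [He [-> ->]]]]; [nra|].
    exists al, (w1 - o1), o1, eta. repeat split; try lra. intros f s.
    rewrite Hrev, Hc by trivial. pt; ring.
  - assert (H0 : on_axis Hyperbolic (psi (0,0,0))) by (apply Hax, on_axis_hyperbolic; lra).
    assert (H3 : on_axis Hyperbolic (psi (1,0,0))) by (apply Hax, on_axis_hyperbolic; lra).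
    pose proof (Hl (1,0,0) (1,0,0)) as L33. pose proof (Hl (0,0,1) (0,0,1)) as L11.
    pose proof (Hl (0,0,1) (1,0,0)) as L13.
    assert (Hc : forall r s, psi (s, 0, r) = padd (psi (0,0,0))
      (padd (pscale r (lin psi (0,0,1))) (pscale s (lin psi (1,0,0))))).
    { intros r s. rewrite <- isometry_comb by trivial. f_equal. apply point_eq; coords; ring. }
    unfold lin in *.
    destruct (psi (0,0,0)) as [[o1 o2] o3], (psi (1,0,0)) as [[w1 w2] w3],
      (psi (0,0,1)) as [[u1 u2] u3].
    apply on_axis_hyperbolic in H0, H3. destruct H0 as [-> ->], H3 as [-> ->].
    coords.
    assert (Hw : (w1 - o1) ^ 2 = 1) by lra.
    assert (Hu3 : u1 = o1) by nra. subst u1.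
    destruct (hyperbola_param u3 u2) as [eta [al [He [-> ->]]]]; [nra|].
    exists al, (w1 - o1), o1, eta. repeat split; try lra. intros f s.
    rewrite Hrev, Hc by trivial. pt; ring.
Qed.

Lemma profile_change_parabolic psi :
  isometry psi -> normalizes Parabolic psi ->
  exists al lam mu, lam <> 0 /\ forall f s,
    psi (profile Par f s)
    = rot Parabolic al (profile Par (fun x => lam * f (lam * x) + mu) (s / lam)).
Proof.
  intros Hi Hn.
  assert (Hax : forall p, on_axis Parabolic p -> on_axis Parabolic (psi p))
    by (intros p; apply normalizes_on_axis; trivial).
  pose proof (fun p q => lin_lor psi p q Hi) as Hl.
  assert (H0 : on_axis Parabolic (psi (0,0,0))) by (apply Hax, on_axis_parabolic; lra).
  assert (H3 : on_axis Parabolic (psi (1,0,1))) by (apply Hax, on_axis_parabolic; lra).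
  pose proof (Hl (1,0,-1) (1,0,-1)) as L11. pose proof (Hl (1,0,-1) (1,0,1)) as L13.
  assert (Hc : forall r s, psi (r + s, 0, r - s) = padd (psi (0,0,0))
      (padd (pscale r (lin psi (1,0,1))) (pscale s (lin psi (1,0,-1))))).
  { intros r s. rewrite <- isometry_comb by trivial. f_equal. apply point_eq; coords; ring. }
  unfold lin in *.
  destruct (psi (0,0,0)) as [[o1 o2] o3], (psi (1,0,1)) as [[w1 w2] w3],
      (psi (1,0,-1)) as [[u1 u2] u3].
  apply on_axis_parabolic in H0, H3. destruct H0 as [-> ->], H3 as [-> ->].
  coords. remember (w3 - o3) as lam eqn:Elam.
  assert (Hlam : lam <> 0) by (intros E; rewrite E in L13; lra).
  assert (E1 : u1 - u3 = 2 / lam) by (apply (Rmult_eq_reg_l lam); trivial; field_simplify; trivial; nra).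
  exists (- lam * u2 / 2), lam, o3. split; trivial. intros f s.
  unfold profile at 1. rewrite Hc. simpl.
  replace (lam * (s / lam)) with s by (field; trivial).
  assert (E2 : u1 + u3 = 2 * o3 - u2 ^ 2 * lam / 2).
  { assert (E3 : (u1 - u3) * (u1 + u3 - 2 * o3) = - u2 ^ 2) by nra.
    rewrite E1 in E3.
    replace (u1 + u3) with (lam / 2 * (2 / lam * (u1 + u3 - 2 * o3)) + 2 * o3) by (field; trivial).
    rewrite E3. field. }
  assert (U1 : u1 = o3 - u2 ^ 2 * lam / 4 + 1 / lam)
    by (replace (1 / lam) with (2 / lam / 2) by (field; trivial); lra).
  assert (U3 : u3 = o3 - u2 ^ 2 * lam / 4 - 1 / lam)
    by (replace (1 / lam) with (2 / lam / 2) by (field; trivial); lra).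
  rewrite U1, U3. pt; try (field; trivial).
Qed.

Definition surface (k : rkind) (phi : point -> point) (f : R -> R) : pset :=
  fun p => exists s t, p = phi (rot (axis_of k) t (profile k f s)).

Lemma surface_change k G phi phi' f' f (al : R) (sg : R -> R) :
  frame (axis_of k) G phi -> frame (axis_of k) G phi' ->
  (forall x, exists s, sg s = x) ->
  (forall s, inv phi (phi' (profile k f' s)) = rot (axis_of k) al (profile k f (sg s))) ->
  surface k phi' f' = surface k phi f.
Proof.
  intros F F' Hsg Hp. pose proof F as [Hi _].
  destruct (frame_change _ _ _ _ F F') as [_ [N1 N2]].
  apply pset_ext. intros q. split.
  - intros [s [t ->]]. destruct (N1 t) as [t' Ht'].
    exists (sg s), (t' + al). rewrite <- rot_add, <- Hp, <- Ht', inv_r by trivial. reflexivity.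
  - intros [x [t ->]]. destruct (Hsg x) as [s <-]. destruct (N2 (t - al)) as [t' Ht'].
    exists s, t'. rewrite <- (inv_r phi (phi' _)), Ht', Hp, rot_add by trivial.
    do 2 f_equal. ring.
Qed.

Lemma circle_in_frame k G phi C :
  frame k G phi -> circle G C ->
  exists q, C (phi q) /\ forall p, C p -> exists t, p = phi (rot k t q).
Proof.
  intros F [[p0 H] _]. pose proof F as [Hi Hf]. exists (inv phi p0). rewrite inv_r by trivial. split.
  - apply H. destruct (frame_exists_element k G phi 0 F) as [g [Hg E]].
    exists g. split; trivial. rewrite <- (inv_r phi p0) by trivial.
    rewrite E, rot_0. reflexivity.
  - intros p Hp. apply H in Hp. destruct Hp as [g [Hg ->]]. apply Hf in Hg.
    destruct Hg as [t Ht]. exists t. rewrite <- Ht, inv_r by trivial. reflexivity.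
Qed.

(* The orbits lie in the affine planes orthogonal to the axis. *)
Definition axis_dir (k : axis) : point :=
  match k with Elliptic => (0, 0, 1) | Hyperbolic => (1, 0, 0) | Parabolic => (1, 0, 1) end.

Lemma rot_axis_dir k t q : lor (rot k t q) (axis_dir k) = lor q (axis_dir k).
Proof. destruct q as [[x y] z], k; coords; simpl; field. Qed.

Lemma coaxial_planes k G phi C1 C2 q1 q2 :
  frame k G phi -> coaxial G C1 C2 -> C1 (phi q1) -> C2 (phi q2) ->
  lor q1 (axis_dir k) <> lor q2 (axis_dir k).
Proof.
  intros F [H1 [H2 H]] Hq1 Hq2 E. apply H. pose proof F as [Hi _].
  destruct (circle_in_frame _ _ _ _ F H1) as [r1 [_ Hr1]].
  destruct (circle_in_frame _ _ _ _ F H2) as [r2 [_ Hr2]].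
  assert (L1 : forall p, C1 p -> lor (inv phi p) (axis_dir k) = lor q1 (axis_dir k)).
  { intros p Hp. apply Hr1 in Hp, Hq1. destruct Hp as [t ->], Hq1 as [t' E'].
    apply isometry_inj in E'; trivial. rewrite E', inv_l, !rot_axis_dir by trivial. reflexivity. }
  assert (L2 : forall p, C2 p -> lor (inv phi p) (axis_dir k) = lor q1 (axis_dir k)).
  { intros p Hp. rewrite E. apply Hr2 in Hp, Hq2. destruct Hp as [t ->], Hq2 as [t' E'].
    apply isometry_inj in E'; trivial. rewrite E', inv_l, !rot_axis_dir by trivial. reflexivity. }
  set (n := lin phi (axis_dir k)).
  exists (cx n, cy n, - cz n), (lor q1 (axis_dir k) + lor (phi (0,0,0)) n). split.
  - intros E0.
    assert (Hn : n = (0,0,0)).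
    { apply point_eq; [apply (f_equal cx) in E0 | apply (f_equal cy) in E0 | apply (f_equal cz) in E0];
      coords; lra. }
    pose proof (fun p => lin_lor phi (axis_dir k) p Hi) as Hl. fold n in Hl. rewrite Hn in Hl.
    destruct k; [specialize (Hl (0,0,1)) | specialize (Hl (1,0,0)) | specialize (Hl (1,0,0))];
      simpl in Hl; coords; lra.
  - intros p Hp.
    assert (L : lor (inv phi p) (axis_dir k) = lor q1 (axis_dir k))
      by (destruct Hp; [apply L1 | apply L2]; trivial).
    rewrite <- L, <- (lin_lor phi (inv phi p)) by trivial. fold n. unfold lin. rewrite inv_r by trivial.
    coords. ring.
Qed.

(** * The profile equation *)

Lemma continuous_Rplus (f g : R -> R) s :
  continuous f s -> continuous g s -> continuous (fun x => f x + g x) s.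
Proof. exact (continuous_plus f g s). Qed.

Lemma continuous_Rminus (f g : R -> R) s :
  continuous f s -> continuous g s -> continuous (fun x => f x - g x) s.
Proof. exact (continuous_minus f g s). Qed.

Lemma continuous_Rmult (f g : R -> R) s :
  continuous f s -> continuous g s -> continuous (fun x => f x * g x) s.
Proof. exact (@continuous_mult _ R_AbsRing f g s). Qed.

Lemma is_derive_Rplus (f g : R -> R) s a b :
  is_derive f s a -> is_derive g s b -> is_derive (fun x => f x + g x) s (a + b).
Proof. exact (is_derive_plus f g s a b). Qed.

Lemma is_derive_Rminus (f g : R -> R) s a b :
  is_derive f s a -> is_derive g s b -> is_derive (fun x => f x - g x) s (a - b).
Proof. exact (is_derive_minus f g s a b). Qed.

Lemma is_derive_Rmult (f g : R -> R) s a b :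
  is_derive f s a -> is_derive g s b -> is_derive (fun x => f x * g x) s (a * g s + f s * b).
Proof. intros Hf Hg. exact (is_derive_mult f g s a b Hf Hg Rmult_comm). Qed.

Lemma is_derive_ext_eq (f g : R -> R) s a b :
  (forall x, f x = g x) -> is_derive f s a -> is_derive g s b -> a = b.
Proof.
  intros E Hf Hg. apply (is_derive_ext f g) in Hf; trivial.
  rewrite <- (is_derive_unique g s a Hf). apply is_derive_unique, Hg.
Qed.

Lemma derive_0_const (g : R -> R) : (forall s, is_derive g s 0) -> forall x y, g x = g y.
Proof.
  intros H x y.
  destruct (MVT_gen g x y (fun _ => 0)) as [c [_ E]].
  - intros; apply H.
  - intros. apply derivable_continuous_pt. exists 0. apply is_derive_Reals, H.
  - lra.
Qed.

Lemma locally_neq_0 (g : R -> R) s : continuous g s -> g s <> 0 -> locally s (fun x => g x <> 0).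
Proof.
  intros Hc H. apply (Hc (fun y => y <> 0)).
  apply (open_neq 0 (g s)); trivial.
Qed.

Section RotationalODE.
Variables (e : R) (f0 f1 f2 f3 f4 : R -> R).
Hypothesis D0 : forall s, is_derive f0 s (f1 s).
Hypothesis D1 : forall s, is_derive f1 s (f2 s).
Hypothesis D2 : forall s, is_derive f2 s (f3 s).
Hypothesis D3 : forall s, is_derive f3 s (f4 s).
Hypothesis C4 : forall s, continuous f4 s.
Hypothesis e_neq_0 : e <> 0.
Hypothesis f_nonzero : exists s, f0 s <> 0.
Hypothesis ode : forall s, f0 s <> 0 -> f0 s * f2 s = f1 s ^ 2 + e.

Let derive_continuous (g g' : R -> R) : (forall s, is_derive g s (g' s)) -> forall s, continuous g s.
Proof. intros H s. apply (ex_derive_continuous g). exists (g' s). apply H. Qed.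

Let C0 := derive_continuous f0 f1 D0.
Let C1 := derive_continuous f1 f2 D1.
Let C2 := derive_continuous f2 f3 D2.
Let C3 := derive_continuous f3 f4 D3.

(* The set of double zeros is closed and open (on the closure of [f0 <> 0] one has
   [f1 ^ 2 + e = f0 * f2]), so its characteristic function is constant. *)
Lemma ode_no_double_zero s : ~ (f0 s = 0 /\ f1 s = 0).
Proof.
  intros Hs.
  set (B := fun s => f0 s = 0 /\ f1 s = 0).
  set (chi := fun s => if excluded_middle_informative (B s) then 1 else 0).
  assert (Hchi : forall x, is_derive chi x 0).
  { intros x. apply (is_derive_ext_loc (fun _ => chi x)); [|apply @is_derive_const].
    unfold chi at 1. destruct (excluded_middle_informative (B x)) as [[Hx0 Hx1]|Hx].
    - assert (L : locally x (fun y => f1 y ^ 2 + e - f0 y * f2 y <> 0)).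
      { apply (locally_neq_0 (fun y => f1 y ^ 2 + e - f0 y * f2 y)).
        - apply (continuous_minus (fun y => f1 y ^ 2 + e) (fun y => f0 y * f2 y)).
          + apply (continuous_plus (fun y => f1 y ^ 2) (fun _ => e)); [|apply continuous_const].
            apply (continuous_comp f1 (fun z => z ^ 2)); [apply C1|].
            apply (ex_derive_continuous (fun z : R => z ^ 2)). auto_derive; trivial.
          + apply (continuous_mult f0 f2); [apply C0 | apply C2].
        - rewrite Hx0, Hx1. replace (0 ^ 2 + e - 0 * f2 x) with e by ring. trivial. }
      assert (L0 : locally x (fun y => f0 y = 0)).
      { revert L. apply filter_imp. intros y Hy. apply NNPP. intros N. apply Hy.
        rewrite ode by trivial. ring. }
      apply locally_locally in L0. revert L0. apply filter_imp. intros y Ly.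
      unfold chi. destruct (excluded_middle_informative (B y)) as [_|N]; trivial.
      exfalso; apply N. split; [apply (locally_singleton y _ Ly)|].
      rewrite <- (is_derive_unique f0 y (f1 y) (D0 y)).
      rewrite (Derive_ext_loc f0 (fun _ => 0) y Ly). apply Derive_const.
    - assert (Hx' : f0 x <> 0 \/ f1 x <> 0) by (apply not_and_or; trivial).
      assert (L : locally x (fun y => f0 y <> 0 \/ f1 y <> 0)).
      { destruct Hx' as [H|H].
        - generalize (locally_neq_0 f0 x (C0 x) H). apply filter_imp. tauto.
        - generalize (locally_neq_0 f1 x (C1 x) H). apply filter_imp. tauto. }
      revert L. apply filter_imp. intros y Hy. unfold chi.
      destruct (excluded_middle_informative (B y)) as [[]|]; trivial. tauto. }
  destruct f_nonzero as [s0 Hs0].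
  pose proof (derive_0_const chi Hchi s s0) as E. unfold chi in E.
  destruct (excluded_middle_informative (B s)); [|contradiction].
  destruct (excluded_middle_informative (B s0)) as [[]|]; [contradiction|lra].
Qed.

Lemma ode_dense (g : R -> R) :
  (forall s, continuous g s) -> (forall s, f0 s <> 0 -> g s = 0) -> forall s, g s = 0.
Proof.
  intros Hg H s. apply NNPP. intros N.
  assert (L : locally s (fun y => f0 y = 0)).
  { generalize (locally_neq_0 g s (Hg s) N). apply filter_imp. intros y Hy.
    apply NNPP. intros N'. apply Hy, H, N'. }
  apply (ode_no_double_zero s). split; [apply (locally_singleton s _ L)|].
  rewrite <- (is_derive_unique f0 s (f1 s) (D0 s)).
  rewrite (Derive_ext_loc f0 (fun _ => 0) s L). apply Derive_const.
Qed.

Ltac cont := repeat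
  match goal with
  | |- continuous (fun x => ?a + ?b) _ => apply (continuous_Rplus (fun x => a) (fun x => b))
  | |- continuous (fun x => ?a - ?b) _ => apply (continuous_Rminus (fun x => a) (fun x => b))
  | |- continuous (fun x => ?a * ?b) _ => apply (continuous_Rmult (fun x => a) (fun x => b))
  | |- continuous (fun x => f0 x) _ => apply C0
  | |- continuous (fun x => f1 x) _ => apply C1
  | |- continuous (fun x => f2 x) _ => apply C2
  | |- continuous (fun x => f3 x) _ => apply C3
  | |- continuous (fun x => f4 x) _ => apply C4
  | |- continuous (fun x => ?a) _ => apply continuous_const
  end.

Lemma ode_first_order s : f0 s * f2 s = f1 s * f1 s + e.
Proof.
  apply Rminus_diag_uniq.
  apply (ode_dense (fun s => f0 s * f2 s - (f1 s * f1 s + e))).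
  - intros x. cont.
  - intros x Hx. rewrite ode by trivial. ring.
Qed.

Lemma ode_third_order s : f0 s * f3 s = f1 s * f2 s.
Proof.
  pose proof ode_first_order as E.
  assert (E1 : is_derive (fun s => f0 s * f2 s) s (f1 s * f2 s + f0 s * f3 s)).
  { apply is_derive_Rmult; trivial. }
  assert (E2 : is_derive (fun s => f1 s * f1 s + e) s (f2 s * f1 s + f1 s * f2 s + 0)).
  { apply is_derive_Rplus; [|apply @is_derive_const].
    apply is_derive_Rmult; [apply D1 | apply D1]. }
  pose proof (is_derive_ext_eq _ _ _ _ _ E E1 E2). lra.
Qed.

Lemma ode_linear : exists K, forall s, f2 s = K * f0 s.
Proof.
  set (d := fun s => f0 s * f0 s + f1 s * f1 s).
  set (n := fun s => f0 s * f2 s + f1 s * f3 s).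
  assert (Hd : forall s, d s <> 0).
  { intros s E. apply (ode_no_double_zero s). unfold d in E. nra. }
  set (d' := fun s => f1 s * f0 s + f0 s * f1 s + (f2 s * f1 s + f1 s * f2 s)).
  set (n' := fun s => f1 s * f2 s + f0 s * f3 s + (f2 s * f3 s + f1 s * f4 s)).
  assert (Dd : forall s, is_derive d s (d' s)).
  { intros s. apply is_derive_Rplus; apply is_derive_Rmult; trivial. }
  assert (Dn : forall s, is_derive n s (n' s)).
  { intros s. apply is_derive_Rplus; apply is_derive_Rmult; trivial. }
  assert (E4 : forall s, f0 s * f4 s = f2 s * f2 s).
  { intros s.
  pose proof ode_third_order as E.
    assert (E1 : is_derive (fun s => f0 s * f3 s) s (f1 s * f3 s + f0 s * f4 s)).
    { apply is_derive_Rmult; [apply D0 | apply D3]. }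
    assert (E2 : is_derive (fun s => f1 s * f2 s) s (f2 s * f2 s + f1 s * f3 s)).
    { apply is_derive_Rmult; [apply D1 | apply D2]. }
    pose proof (is_derive_ext_eq _ _ _ _ _ E E1 E2). lra. }
  assert (W : forall s, n' s * d s - n s * d' s = 0).
  { apply ode_dense.
    - intros s. unfold n', d, n, d'. cont.
    - intros s Hs. pose proof (ode_third_order s) as V. specialize (E4 s).
      assert (F3 : f3 s = f1 s * f2 s / f0 s) by (rewrite <- V; field; trivial).
      assert (F4 : f4 s = f2 s * f2 s / f0 s) by (rewrite <- E4; field; trivial).
      unfold n', d, n, d'. rewrite F3, F4. field. trivial. }
  set (k := fun s => n s / d s).
  assert (Dk : forall s, is_derive k s 0).
  { intros s. replace 0 with ((n' s * d s - n s * d' s) / d s ^ 2).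
    - apply is_derive_div; trivial.
    - rewrite W. field. trivial. }
  exists (k 0). intros s. apply Rminus_diag_uniq.
  revert s. apply ode_dense.
  - intros s. cont.
  - intros s Hs. rewrite (derive_0_const k Dk 0 s). unfold k, n, d.
    pose proof (ode_third_order s) as V.
    assert (F3 : f3 s = f1 s * f2 s / f0 s) by (rewrite <- V; field; trivial).
    rewrite F3. field. split; trivial. apply Hd.
Qed.
End RotationalODE.

(* The sinh, sin and cosh profiles are the solutions for
   [e = -1, K > 0], [e = -1, K < 0] and [e = 1, K > 0]. *)
Definition linear_profile (e K : R) (f : R -> R) : Prop :=
  exists f1, (forall s, is_derive f s (f1 s)) /\ (forall s, is_derive f1 s (K * f s)) /\
    forall s, f1 s ^ 2 + e = K * f s ^ 2.

Lemma smooth_is_derive f : (forall n s, ex_derive_n f n s) ->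
  forall n s, is_derive (Derive_n f n) s (Derive_n f (S n) s).
Proof. intros H n s. apply Derive_correct. apply (H (S n) s). Qed.

Lemma smooth_linear_profile e f :
  e <> 0 -> (forall n s, ex_derive_n f n s) -> (exists s, f s <> 0) ->
  (forall s, f s <> 0 -> f s * Derive_n f 2 s = Derive f s ^ 2 + e) ->
  exists K, linear_profile e K f.
Proof.
  intros He Hf Hn Ho. pose proof (smooth_is_derive f Hf) as D.
  assert (C4 : forall s, continuous (Derive_n f 4) s)
    by (intros s; apply (ex_derive_continuous (Derive_n f 4)); apply (Hf 5%nat s)).
  destruct (ode_linear e f (Derive_n f 1) (Derive_n f 2) (Derive_n f 3) (Derive_n f 4)) as [K HK];
    trivial; try apply D.
  exists K, (Derive f). split; [|split].
  - apply (D 0%nat).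
  - intros s. rewrite <- HK. apply (D 1%nat).
  - intros s.
    pose proof (ode_first_order e f (Derive_n f 1) (Derive_n f 2) (Derive_n f 3)
       (D 0%nat) (D 1%nat) (D 2%nat) He Hn Ho s) as E.
    rewrite HK in E. change (Derive_n f 1 s) with (Derive f s) in E. lra.
Qed.

Lemma linear_profile_cosh e a f : a <> 0 -> linear_profile e (a ^ 2) f -> forall s0,
  exists p q, a ^ 2 * q ^ 2 + e = a ^ 2 * p ^ 2 /\
    forall s, f s = p * cosh (a * (s - s0)) + q * sinh (a * (s - s0)).
Proof.
  intros Ha [f1 [D0 [D1 E]]] s0.
  set (A := fun s => f s * cosh (a * (s - s0)) - f1 s / a * sinh (a * (s - s0))).
  set (B := fun s => f1 s / a * cosh (a * (s - s0)) - f s * sinh (a * (s - s0))).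
  assert (Df : forall s, ex_derive f s) by (intros s; exists (f1 s); apply D0).
  assert (Df1 : forall s, ex_derive f1 s) by (intros s; exists (a ^ 2 * f s); apply D1).
  assert (U0 : forall s, Derive (fun x => f x) s = f1 s) by (intros s; apply is_derive_unique, D0).
  assert (U1 : forall s, Derive (fun x => f1 x) s = a ^ 2 * f s) by (intros s; apply is_derive_unique, D1).
  assert (DA : forall s, is_derive A s 0).
  { intros s. unfold A. auto_derive; [repeat split; trivial|].
    rewrite U0, U1. unfold Rminus. field; trivial. }
  assert (DB : forall s, is_derive B s 0).
  { intros s. unfold B. auto_derive; [repeat split; trivial|].
    rewrite U0, U1. unfold Rminus. field; trivial. }
  assert (Z : a * (s0 - s0) = 0) by ring.
  exists (f s0), (f1 s0 / a). split.
  - rewrite <- E. field. trivial.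
  - intros s. pose proof (derive_0_const A DA s s0) as EA.
    pose proof (derive_0_const B DB s s0) as EB. unfold A, B in EA, EB.
    rewrite Z, cosh_0, sinh_0 in EA, EB.
    replace (f s0) with (f s0 * 1 - f1 s0 / a * 0) by ring. rewrite <- EA.
    replace (f1 s0 / a) with (f1 s0 / a * 1 - f s0 * 0) by ring. rewrite <- EB.
    pose proof (cosh2 (a * (s - s0))) as C.
    transitivity (f s * (cosh (a * (s - s0)) ^ 2 - sinh (a * (s - s0)) ^ 2)); [rewrite C; ring|ring].
Qed.

Lemma linear_profile_cos e a f : a <> 0 -> linear_profile e (- a ^ 2) f -> forall s0,
  exists p q, a ^ 2 * (p ^ 2 + q ^ 2) = - e /\
    forall s, f s = p * cos (a * (s - s0)) + q * sin (a * (s - s0)).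
Proof.
  intros Ha [f1 [D0 [D1 E]]] s0.
  set (A := fun s => f s * cos (a * (s - s0)) - f1 s / a * sin (a * (s - s0))).
  set (B := fun s => f1 s / a * cos (a * (s - s0)) + f s * sin (a * (s - s0))).
  assert (Df : forall s, ex_derive f s) by (intros s; exists (f1 s); apply D0).
  assert (Df1 : forall s, ex_derive f1 s) by (intros s; exists (- a ^ 2 * f s); apply D1).
  assert (U0 : forall s, Derive (fun x => f x) s = f1 s) by (intros s; apply is_derive_unique, D0).
  assert (U1 : forall s, Derive (fun x => f1 x) s = - a ^ 2 * f s) by (intros s; apply is_derive_unique, D1).
  assert (DA : forall s, is_derive A s 0).
  { intros s. unfold A. auto_derive; [repeat split; trivial|].
    rewrite U0, U1. unfold Rminus. field; trivial. }
  assert (DB : forall s, is_derive B s 0).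
  { intros s. unfold B. auto_derive; [repeat split; trivial|].
    rewrite U0, U1. unfold Rminus. field; trivial. }
  assert (Z : a * (s0 - s0) = 0) by ring.
  exists (f s0), (f1 s0 / a). split.
  - specialize (E s0). replace e with (- a ^ 2 * f s0 ^ 2 - f1 s0 ^ 2) by lra. field. trivial.
  - intros s. pose proof (derive_0_const A DA s s0) as EA.
    pose proof (derive_0_const B DB s s0) as EB. unfold A, B in EA, EB.
    rewrite Z, cos_0, sin_0 in EA, EB.
    replace (f s0) with (f s0 * 1 - f1 s0 / a * 0) by ring. rewrite <- EA.
    replace (f1 s0 / a) with (f1 s0 / a * 1 + f s0 * 0) by ring. rewrite <- EB.
    pose proof (sin2_cos2 (a * (s - s0))) as C. unfold Rsqr in C.
    transitivity (f s * (sin (a * (s - s0)) * sin (a * (s - s0)) + cos (a * (s - s0)) * cos (a * (s - s0)))); [rewrite C; ring|ring].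
Qed.

Lemma linear_profile_change e K f eta eps o : eta ^ 2 = 1 -> eps ^ 2 = 1 ->
  linear_profile e K f -> linear_profile e K (fun x => eta * f (eps * (x - o))).
Proof.
  intros He Hp [f1 [D0 [D1 E]]].
  exists (fun x => eta * eps * f1 (eps * (x - o))). split; [|split].
  - intros s.
    assert (D : is_derive (fun x => f (eps * (x - o))) s (eps * f1 (eps * (s - o)))).
    { apply (is_derive_comp f (fun x => eps * (x - o))); [apply D0|]. auto_derive; trivial; ring. }
    replace (eta * eps * f1 (eps * (s - o))) with (eta * (eps * f1 (eps * (s - o)))) by ring.
    apply is_derive_scal, D.
  - intros s.
    assert (D : is_derive (fun x => f1 (eps * (x - o))) s (eps * (K * f (eps * (s - o))))).
    { apply (is_derive_comp f1 (fun x => eps * (x - o))); [apply D1|]. auto_derive; trivial; ring. }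
    replace (K * (eta * f (eps * (s - o)))) with (eta * eps * (eps * (K * f (eps * (s - o))))).
    + apply is_derive_scal, D.
    + transitivity (eps ^ 2 * (K * (eta * f (eps * (s - o))))); [ring|rewrite Hp; ring].
  - intros s.
    replace ((eta * eps * f1 (eps * (s - o))) ^ 2) with (eta ^ 2 * eps ^ 2 * f1 (eps * (s - o)) ^ 2) by ring.
    replace ((eta * f (eps * (s - o))) ^ 2) with (eta ^ 2 * f (eps * (s - o)) ^ 2) by ring.
    rewrite He, Hp, <- (Rmult_1_l (f (eps * (s - o)) ^ 2)). specialize (E (eps * (s - o))). lra.
Qed.

Lemma parabolic_ode f :
  (forall n s, ex_derive_n f n s) ->
  (forall s, s <> 0 -> s * Derive_n f 2 s = 2 * Derive f s) ->
  exists a b, forall s, f s = a * s ^ 3 + b.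
Proof.
  intros Hf H. pose proof (smooth_is_derive f Hf) as D.
  assert (dense : forall g, (forall s, continuous g s) -> (forall s, s <> 0 -> g s = 0) -> forall s, g s = 0).
  { intros g Hg H0 s. apply NNPP. intros N.
    destruct (locally_neq_0 g s (Hg s) N) as [eps He].
    destruct (Req_dec s 0) as [->|Hs]; [|apply N, H0; trivial].
    pose proof (cond_pos eps).
    apply (He (eps / 2)).
    - unfold ball; simpl. unfold AbsRing_ball, abs, minus, plus, opp; simpl.
      rewrite Ropp_0, Rplus_0_r, Rabs_pos_eq; lra.
    - apply H0. lra. }
  assert (C : forall n s, continuous (Derive_n f n) s)
    by (intros n s; apply (ex_derive_continuous (Derive_n f n)); apply (Hf (S n) s)).
  assert (E2 : forall s, s * Derive_n f 2 s = 2 * Derive_n f 1 s).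
  { intros s. apply Rminus_diag_uniq. revert s.
    apply dense.
    - intros s. apply (continuous_Rminus (fun s => s * Derive_n f 2 s) (fun s => 2 * Derive_n f 1 s)).
      + apply (continuous_Rmult (fun s => s) (Derive_n f 2)); [apply continuous_id | apply C].
      + apply (continuous_Rmult (fun _ => 2) (Derive_n f 1)); [apply continuous_const | apply C].
    - intros s Hs. rewrite H by trivial. apply Rminus_diag_eq; reflexivity. }
  assert (step : forall c n, (forall s, s * Derive_n f (S n) s = c * Derive_n f n s) ->
     forall s, s * Derive_n f (S (S n)) s = (c - 1) * Derive_n f (S n) s).
  { intros c n Hn s.
  pose proof Hn as E.
    assert (E1 : is_derive (fun s => s * Derive_n f (S n) s) s
       (1 * Derive_n f (S n) s + s * Derive_n f (S (S n)) s)).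
    { apply is_derive_Rmult; [apply @is_derive_id | apply D]. }
    assert (E3 : is_derive (fun s => c * Derive_n f n s) s (c * Derive_n f (S n) s))
      by (apply is_derive_scal, D).
    pose proof (is_derive_ext_eq _ _ _ _ _ E E1 E3). lra. }
  pose proof (step _ _ E2) as E3. pose proof (step _ _ E3) as E4.
  assert (Z4 : forall s, Derive_n f 4 s = 0).
  { apply dense; [apply C|]. intros s Hs. apply (Rmult_eq_reg_l s); trivial.
    rewrite E4. ring. }
  assert (K3 : forall s, Derive_n f 3 s = Derive_n f 3 0).
  { intros s. apply derive_0_const. intros x. rewrite <- (Z4 x). apply D. }
  set (c := Derive_n f 3 0) in *.
  assert (F1 : forall s, Derive_n f 1 s = c / 2 * s ^ 2).
  { intros s. pose proof (E2 s). pose proof (E3 s) as E3s. rewrite K3 in E3s.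
    replace (Derive_n f 2 s) with (c * s) in * by lra. lra. }
  exists (c / 6), (f 0). intros s.
  assert (DB : forall x, is_derive (fun x => f x - c / 6 * x ^ 3) x 0).
  { intros x. replace 0 with (Derive_n f 1 x - c / 2 * x ^ 2) by (rewrite F1; ring).
    apply is_derive_Rminus; [apply (D 0%nat)|]. auto_derive; trivial; field. }
  pose proof (derive_0_const _ DB s 0) as E. simpl in E. lra.
Qed.

(** * Curvature of rotational surfaces *)

Lemma dvec_eq (c : R -> point) (a1 a2 a3 : R -> R) u b1 b2 b3 :
  (forall v, c v = (a1 v, a2 v, a3 v)) ->
  is_derive a1 u b1 -> is_derive a2 u b2 -> is_derive a3 u b3 ->
  dvec c u = (b1, b2, b3).
Proof.
  intros H H1 H2 H3. unfold dvec.
  rewrite (Derive_ext (fun v => cx (c v)) a1), (Derive_ext (fun v => cy (c v)) a2),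
    (Derive_ext (fun v => cz (c v)) a3)
    by (intros v; rewrite H; reflexivity).
  rewrite (is_derive_unique _ _ _ H1), (is_derive_unique _ _ _ H2), (is_derive_unique _ _ _ H3).
  reflexivity.
Qed.

Definition curvature_numerator (X : R -> R -> point) (s t : R) : R :=
  let N := lcross (Xs X s t) (Xt X s t) in
  lor N (Xss X s t) * ffG X s t - 2 * lor N (Xst X s t) * ffF X s t
  + lor N (Xtt X s t) * ffE X s t.

Lemma lor_scale_l a p q : lor (pscale a p) q = a * lor p q.
Proof. coords; ring. Qed.
Lemma lor_scale_r a p q : lor p (pscale a q) = a * lor p q.
Proof. coords; ring. Qed.

Lemma mean_curvature_eq_0 X s t : ffW X s t <> 0 ->
  (mean_curvature X s t = 0 <-> curvature_numerator X s t = 0).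
Proof.
  intros HW. set (N := lcross (Xs X s t) (Xt X s t)).
  set (q := / sqrt (Rabs (ffW X s t))).
  assert (Hq : q <> 0).
  { apply Rinv_neq_0_compat. pose proof (sqrt_lt_R0 _ (Rabs_pos_lt _ HW)). lra. }
  assert (HN : lor N N = - ffW X s t).
  { unfold N, ffW, ffE, ffF, ffG. coords. ring. }
  assert (E : mean_curvature X s t = - q ^ 3 / 2 * curvature_numerator X s t).
  { unfold mean_curvature, curvature_numerator, unit_normal. fold N q.
    rewrite !lor_scale_l, !lor_scale_r, HN. field. trivial. }
  rewrite E. split; intros H; [|rewrite H; ring].
  apply Rmult_integral in H. destruct H as [H|H]; trivial.
  exfalso. assert (q ^ 3 <> 0) by (apply pow_nonzero; trivial). lra.
Qed.

Definition e_of (k : rkind) : R := match k with HypI => 1 | _ => -1 end.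
Definition metric_sign (k : rkind) : R := match k with Ell => 1 | _ => -1 end.
Definition meridian_sign (k : rkind) : R := match k with HypII => -1 | _ => 1 end.

Section RotationalSurface.
Variables f f1 f2 : R -> R.
Hypothesis D0 : forall s, is_derive f s (f1 s).
Hypothesis D1 : forall s, is_derive f1 s (f2 s).

Let Df s : ex_derive f s. Proof. exists (f1 s); apply D0. Qed.
Let Df1 s : ex_derive f1 s. Proof. exists (f2 s); apply D1. Qed.
Let U0 s : Derive (fun x => f x) s = f1 s. Proof. apply is_derive_unique, D0. Qed.
Let U1 s : Derive (fun x => f1 x) s = f2 s. Proof. apply is_derive_unique, D1. Qed.

Definition rotational (k : rkind) (s t : R) : point := rot (axis_of k) t (profile k f s).

Ltac deriv := auto_derive; [repeat split; trivial | rewrite ?U0, ?U1; try field].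

Lemma elliptic_curvature s t :
  ffW (rotational Ell) s t = f s ^ 2 * (f1 s ^ 2 - 1) /\
  ffE (rotational Ell) s t = f1 s ^ 2 - 1 /\
  curvature_numerator (rotational Ell) s t = - f s ^ 2 * (f s * f2 s - f1 s ^ 2 + 1).
Proof.
  set (X := rotational Ell).
  assert (HX : forall s t, X s t = (f s * cos t, f s * sin t, s))
    by (intros; unfold X, rotational; simpl; pt; ring).
  assert (HXs : forall s t, Xs X s t = (f1 s * cos t, f1 s * sin t, 1)).
  { intros u v. eapply dvec_eq; [intros; apply HX|deriv..]. }
  assert (HXt : forall s t, Xt X s t = (- f s * sin t, f s * cos t, 0)).
  { intros u v. eapply dvec_eq; [intros; apply HX|deriv..]. }
  assert (HXss : Xss X s t = (f2 s * cos t, f2 s * sin t, 0)).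
  { eapply dvec_eq; [intros; apply HXs|deriv..]. }
  assert (HXst : Xst X s t = (- f1 s * sin t, f1 s * cos t, 0)).
  { eapply dvec_eq; [intros; apply HXs|deriv..]. }
  assert (HXtt : Xtt X s t = (- f s * cos t, - f s * sin t, 0)).
  { eapply dvec_eq; [intros; apply HXt|deriv..]. }
  unfold ffW, curvature_numerator, ffE, ffF, ffG.
  rewrite HXs, HXt, HXss, HXst, HXtt. clear - s t. coords.
  assert (C : cos t ^ 2 = 1 - sin t ^ 2) by (pose proof (sin2_cos2 t) as E; unfold Rsqr in E; lra).
  set (x := cos t) in *. set (y := sin t) in *. clearbody x y.
  repeat split; ring [C].
Qed.

Lemma hyperbolic1_curvature s t :
  ffW (rotational HypI) s t = - f s ^ 2 * (f1 s ^ 2 + 1) /\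
  ffE (rotational HypI) s t = f1 s ^ 2 + 1 /\
  curvature_numerator (rotational HypI) s t = f s ^ 2 * (f s * f2 s - f1 s ^ 2 - 1).
Proof.
  set (X := rotational HypI).
  assert (HX : forall s t, X s t = (s, f s * cosh t, f s * sinh t))
    by (intros; unfold X, rotational; simpl; pt; ring).
  assert (HXs : forall s t, Xs X s t = (1, f1 s * cosh t, f1 s * sinh t)).
  { intros u v. eapply dvec_eq; [intros; apply HX|deriv..]. }
  assert (HXt : forall s t, Xt X s t = (0, f s * sinh t, f s * cosh t)).
  { intros u v. eapply dvec_eq; [intros; apply HX|deriv..]. }
  assert (HXss : Xss X s t = (0, f2 s * cosh t, f2 s * sinh t)).
  { eapply dvec_eq; [intros; apply HXs|deriv..]. }
  assert (HXst : Xst X s t = (0, f1 s * sinh t, f1 s * cosh t)).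
  { eapply dvec_eq; [intros; apply HXs|deriv..]. }
  assert (HXtt : Xtt X s t = (0, f s * cosh t, f s * sinh t)).
  { eapply dvec_eq; [intros; apply HXt|deriv..]. }
  unfold ffW, curvature_numerator, ffE, ffF, ffG.
  rewrite HXs, HXt, HXss, HXst, HXtt. clear - s t. coords.
  pose proof (cosh2 t) as C.
  set (x := cosh t) in *. set (y := sinh t) in *. clearbody x y.
  repeat split; ring [C].
Qed.

Lemma hyperbolic2_curvature s t :
  ffW (rotational HypII) s t = - f s ^ 2 * (f1 s ^ 2 - 1) /\
  ffE (rotational HypII) s t = 1 - f1 s ^ 2 /\
  curvature_numerator (rotational HypII) s t = f s ^ 2 * (f s * f2 s - f1 s ^ 2 + 1).
Proof.
  set (X := rotational HypII).
  assert (HX : forall s t, X s t = (s, f s * sinh t, f s * cosh t))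
    by (intros; unfold X, rotational; simpl; pt; ring).
  assert (HXs : forall s t, Xs X s t = (1, f1 s * sinh t, f1 s * cosh t)).
  { intros u v. eapply dvec_eq; [intros; apply HX|deriv..]. }
  assert (HXt : forall s t, Xt X s t = (0, f s * cosh t, f s * sinh t)).
  { intros u v. eapply dvec_eq; [intros; apply HX|deriv..]. }
  assert (HXss : Xss X s t = (0, f2 s * sinh t, f2 s * cosh t)).
  { eapply dvec_eq; [intros; apply HXs|deriv..]. }
  assert (HXst : Xst X s t = (0, f1 s * cosh t, f1 s * sinh t)).
  { eapply dvec_eq; [intros; apply HXs|deriv..]. }
  assert (HXtt : Xtt X s t = (0, f s * sinh t, f s * cosh t)).
  { eapply dvec_eq; [intros; apply HXt|deriv..]. }
  unfold ffW, curvature_numerator, ffE, ffF, ffG.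
  rewrite HXs, HXt, HXss, HXst, HXtt. clear - s t. coords.
  pose proof (cosh2 t) as C.
  set (x := cosh t) in *. set (y := sinh t) in *. clearbody x y.
  repeat split; ring [C].
Qed.

Lemma parabolic_curvature s :
  ffW (rotational Par) s 0 = 16 * s ^ 2 * f1 s /\
  curvature_numerator (rotational Par) s 0 = - 16 * s ^ 2 * (s * f2 s - 2 * f1 s).
Proof.
  set (X := rotational Par).
  assert (HX : forall s t, X s t = (f s + s * (1 - t ^ 2), - 2 * t * s, f s - s * (1 + t ^ 2)))
    by (intros; unfold X, rotational; simpl; pt; field).
  assert (HXs : forall s t, Xs X s t = (f1 s + (1 - t ^ 2), - 2 * t, f1 s - (1 + t ^ 2))).
  { intros u v. eapply dvec_eq; [intros; apply HX|deriv..]. }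
  assert (HXt : forall s t, Xt X s t = (- 2 * s * t, - 2 * s, - 2 * s * t)).
  { intros u v. eapply dvec_eq; [intros; apply HX|deriv..]. }
  assert (HXss : Xss X s 0 = (f2 s, 0, f2 s)).
  { eapply dvec_eq; [intros; apply HXs|deriv..]. }
  assert (HXst : Xst X s 0 = (0, -2, 0)).
  { eapply dvec_eq; [intros; apply HXs|deriv..]. }
  assert (HXtt : Xtt X s 0 = (- 2 * s, 0, - 2 * s)).
  { eapply dvec_eq; [intros; apply HXt|deriv..]. }
  unfold ffW, curvature_numerator, ffE, ffF, ffG.
  rewrite HXs, HXt, HXss, HXst, HXtt. clear - s. coords.
  split; ring.
Qed.
End RotationalSurface.

Lemma rotational_curvature k f f1 f2 s t :
  k <> Par -> (forall s, is_derive f s (f1 s)) -> (forall s, is_derive f1 s (f2 s)) ->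
  ffW (rotational f k) s t = metric_sign k * f s ^ 2 * (f1 s ^ 2 + e_of k) /\
  ffE (rotational f k) s t = meridian_sign k * (f1 s ^ 2 + e_of k) /\
  curvature_numerator (rotational f k) s t
  = - metric_sign k * f s ^ 2 * (f s * f2 s - f1 s ^ 2 - e_of k).
Proof.
  intros Hk D0 D1. destruct k; try congruence; simpl.
  - destruct (elliptic_curvature f f1 f2 D0 D1 s t) as [-> [-> ->]]. repeat split; ring.
  - destruct (hyperbolic1_curvature f f1 f2 D0 D1 s t) as [-> [-> ->]]. repeat split; ring.
  - destruct (hyperbolic2_curvature f f1 f2 D0 D1 s t) as [-> [-> ->]]. repeat split; ring.
Qed.

Lemma on_axis_profile k f s : k <> Par -> (on_axis (axis_of k) (profile k f s) <-> f s = 0).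
Proof.
  intros Hk; destruct k; try congruence; simpl.
  - rewrite on_axis_elliptic. tauto.
  - rewrite on_axis_hyperbolic. tauto.
  - rewrite on_axis_hyperbolic. tauto.
Qed.

Lemma catenary_linear_profile c k f : k <> Par -> catenary c k f ->
  exists K, linear_profile (e_of k) K f /\
    exists s t, 0 < f s ^ 2 /\ induced_metric c (rotational f k) s t /\
      ffW (rotational f k) s t = metric_sign k * K * f s ^ 4.
Proof.
  intros Hk [Hs [[s0 H0] H]]. rewrite (on_axis_profile k f s0 Hk) in H0.
  assert (D0 : forall s, is_derive f s (Derive f s)) by apply (smooth_is_derive f Hs 0).
  assert (D1 : forall s, is_derive (Derive f) s (Derive_n f 2 s)) by apply (smooth_is_derive f Hs 1).
  destruct (smooth_linear_profile (e_of k) f) as [K HK]; trivial.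
  - destruct k; simpl; lra.
  - exists s0; trivial.
  - intros s Hfs.
    destruct (H s 0) as [Hm Hc]; [rewrite (on_axis_profile k f s Hk); trivial|].
    assert (HW : ffW (rotational f k) s 0 <> 0).
    { destruct c; simpl in Hm; unfold rotational; lra. }
    apply (mean_curvature_eq_0 (rotational f k)) in Hc; trivial.
    destruct (rotational_curvature k f _ _ s 0 Hk D0 D1) as [_ [_ E]]. rewrite E in Hc.
    apply Rmult_integral in Hc. destruct Hc as [Hc|Hc]; [|lra].
    exfalso. apply Rmult_integral in Hc. destruct Hc as [Hc|Hc].
    + destruct k; simpl in Hc; lra.
    + revert Hc. apply pow_nonzero; trivial.
  - exists K. split; trivial. exists s0, 0.
    assert (0 < f s0 ^ 2) by (apply pow2_gt_0; trivial). split; trivial.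
    destruct (H s0 0) as [Hm _]; [rewrite (on_axis_profile k f s0 Hk); trivial|].
    split; trivial. destruct (rotational_curvature k f _ _ s0 0 Hk D0 D1) as [-> _].
    destruct HK as [f1 [E0 [_ E]]].
    rewrite (is_derive_unique f s0 (f1 s0) (E0 s0)), E. ring.
Qed.

Lemma pow4_pos x : 0 < x ^ 2 -> 0 < x ^ 4.
Proof. intros; replace (x ^ 4) with (x ^ 2 * x ^ 2) by ring. nra. Qed.

Lemma catenary_K_pos c k f :
  (c, k) = (Spacelike, Ell) \/ (c, k) = (Timelike, HypI) \/ (c, k) = (Timelike, HypII) ->
  catenary c k f -> exists a, 0 < a /\ linear_profile (e_of k) (a ^ 2) f.
Proof.
  intros Hck Hf.
  assert (Hk : k <> Par) by (intros ->; destruct Hck as [H|[H|H]]; congruence).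
  destruct (catenary_linear_profile c k f Hk Hf) as [K [HK [s [t [Hp [Hm HW]]]]]].
  assert (0 < K).
  { apply pow4_pos in Hp.
    destruct Hck as [H|[H|H]]; injection H; intros -> ->; simpl in Hm, HW; nra. }
  exists (sqrt K). split; [apply sqrt_lt_R0; trivial|].
  rewrite pow2_sqrt by lra. trivial.
Qed.

Lemma catenary_K_neg c k f :
  (c, k) = (Timelike, Ell) \/ (c, k) = (Spacelike, HypII) ->
  catenary c k f -> exists a, 0 < a /\ linear_profile (-1) (- a ^ 2) f.
Proof.
  intros Hck Hf.
  assert (Hk : k <> Par) by (intros ->; destruct Hck as [H|H]; congruence).
  assert (He : e_of k = -1) by (destruct Hck as [H|H]; injection H; intros -> ->; reflexivity).
  rewrite <- He.
  destruct (catenary_linear_profile c k f Hk Hf) as [K [HK [s [t [Hp [Hm HW]]]]]].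
  assert (K < 0).
  { apply pow4_pos in Hp.
    destruct Hck as [H|H]; injection H; intros -> ->; simpl in Hm, HW; nra. }
  exists (sqrt (- K)). split; [apply sqrt_lt_R0; lra|].
  rewrite pow2_sqrt, Ropp_involutive by lra. trivial.
Qed.

Lemma sin_smooth a p q n : exists p' q', forall s,
  Derive_n (fun s => p * cos (a * s) + q * sin (a * s)) n s = p' * cos (a * s) + q' * sin (a * s).
Proof.
  induction n as [|n [p' [q' IH]]].
  - exists p, q. reflexivity.
  - exists (a * q'), (- a * p'). intros s. simpl.
    rewrite (Derive_ext _ _ s IH). apply is_derive_unique. auto_derive; trivial. ring.
Qed.

Lemma catenary_sin c k a b : a <> 0 ->
  (c, k) = (Timelike, Ell) \/ (c, k) = (Spacelike, HypII) ->
  catenary c k (fun s => sin (a * s + b) / a).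
Proof.
  intros Ha Hck. set (f := fun s => sin (a * s + b) / a).
  assert (Hk : k <> Par) by (intros ->; destruct Hck as [H|H]; congruence).
  assert (He : e_of k = -1) by (destruct Hck as [H|H]; injection H; intros -> ->; reflexivity).
  assert (D0 : forall s, is_derive f s (cos (a * s + b))).
  { intros s. unfold f. auto_derive; trivial. field; trivial. }
  assert (D1 : forall s, is_derive (fun s => cos (a * s + b)) s (- a * sin (a * s + b))).
  { intros s. auto_derive; trivial. ring. }
  split; [|split].
  - intros [|n] s; [exact I|]. simpl.
    destruct (sin_smooth a (sin b / a) (cos b / a) n) as [p' [q' E]].
    apply (ex_derive_ext (fun s => p' * cos (a * s) + q' * sin (a * s))).
    + intros x. rewrite <- E. apply Derive_n_ext. intros y. unfold f. rewrite sin_plus. field; trivial.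
    + auto_derive; trivial.
  - exists ((PI / 2 - b) / a). rewrite on_axis_profile by trivial. unfold f.
    replace (a * ((PI / 2 - b) / a) + b) with (PI / 2) by (field; trivial).
    rewrite sin_PI2. unfold Rdiv. rewrite Rmult_1_l. apply Rinv_neq_0_compat; trivial.
  - intros s t. rewrite on_axis_profile by trivial. intros Hfs.
    destruct (rotational_curvature k f _ _ s t Hk D0 D1) as [EW [EE EN]].
    fold (rotational f k).
    assert (Hp : 0 < f s ^ 2) by (apply pow2_gt_0; trivial).
    assert (Hneg : cos (a * s + b) ^ 2 + e_of k = - a ^ 2 * f s ^ 2).
    { rewrite He. unfold f. pose proof (sin2_cos2 (a * s + b)) as E. unfold Rsqr in E.
      transitivity (- (sin (a * s + b) * sin (a * s + b))); [lra | field; trivial]. }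
    assert (Ha2 : 0 < a ^ 2) by (apply pow2_gt_0; trivial).
    assert (Hpp : 0 < a ^ 2 * f s ^ 2) by (apply Rmult_lt_0_compat; trivial).
    rewrite Hneg in EW, EE.
    assert (HW : ffW (rotational f k) s t <> 0).
    { rewrite EW. destruct k; simpl; try congruence; nra. }
    split.
    + destruct Hck as [H|H]; injection H; intros -> ->; simpl in *; [nra|split; nra].
    + apply mean_curvature_eq_0; trivial. rewrite EN.
      replace (f s * (- a * sin (a * s + b)) - cos (a * s + b) ^ 2 - e_of k)
        with (f s * (- a * sin (a * s + b)) - (cos (a * s + b) ^ 2 + e_of k)) by ring.
      rewrite Hneg. unfold f. field. trivial.
Qed.

Lemma catenary_parabolic c f : catenary c Par f -> exists a b, forall s, f s = a * s ^ 3 + b.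
Proof.
  intros [Hs [_ H]].
  apply parabolic_ode; trivial. intros s Hs0.
  assert (D0 : forall s, is_derive f s (Derive f s)) by apply (smooth_is_derive f Hs 0).
  assert (D1 : forall s, is_derive (Derive f) s (Derive_n f 2 s)) by apply (smooth_is_derive f Hs 1).
  destruct (H s 0) as [Hm Hc]; [simpl; rewrite on_axis_parabolic; lra|].
  change (induced_metric c (rotational f Par) s 0) in Hm.
  assert (HW : ffW (rotational f Par) s 0 <> 0) by (destruct c; unfold induced_metric in Hm; lra).
  apply (proj1 (mean_curvature_eq_0 (rotational f Par) s 0 HW)) in Hc.
  destruct (parabolic_curvature f _ _ D0 D1 s) as [_ E]. rewrite E in Hc.
  apply Rmult_integral in Hc. destruct Hc as [Hc|Hc]; [|lra].
  exfalso. assert (0 < s ^ 2) by (apply pow2_gt_0; trivial). lra.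
Qed.

(** * Profiles through two given points *)

Lemma number_le_1 (A : pset -> Prop) : (forall S S', A S -> A S' -> S = S') ->
  exists n, number A n /\ (n = 0 \/ n = 1)%nat.
Proof.
  intros H. destruct (classic (exists S, A S)) as [[S HS]|N].
  - exists 1%nat. split; [|tauto]. exists (S :: nil). repeat split.
    + constructor; [simpl; tauto|constructor].
    + intros [->|[]]; trivial.
    + intros HS'. left. apply H; trivial.
  - exists 0%nat. split; [|tauto]. exists nil. repeat split.
    + constructor.
    + intros [].
    + intros HS. apply N. exists S; trivial.
Qed.

Lemma number_le_2 (A : pset -> Prop) :
  (forall S1 S2 S3, A S1 -> A S2 -> A S3 -> S1 = S2 \/ S1 = S3 \/ S2 = S3) ->
  exists n, number A n /\ (n = 0 \/ n = 1 \/ n = 2)%nat.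
Proof.
  intros H. destruct (classic (forall S S', A S -> A S' -> S = S')) as [H1|N].
  - destruct (number_le_1 A H1) as [n [Hn Hn']]. exists n. split; trivial. tauto.
  - apply not_all_ex_not in N. destruct N as [S1 N].
    apply not_all_ex_not in N. destruct N as [S2 N].
    apply imply_to_and in N. destruct N as [A1 N]. apply imply_to_and in N. destruct N as [A2 N].
    exists 2%nat. split; [|tauto]. exists (S1 :: S2 :: nil). repeat split.
    + constructor; [simpl; intros [->|[]]; tauto|]. constructor; [simpl; tauto|constructor].
    + intros [->|[->|[]]]; trivial.
    + intros A3. simpl. destruct (H S1 S2 S A1 A2 A3) as [E|[E|E]]; subst; tauto.
Qed.

Lemma strict_increase (g g' : R -> R) a b : a < b ->
  (forall x, a <= x <= b -> is_derive g x (g' x)) ->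
  (forall x, a < x < b -> 0 < g' x) -> g a < g b.
Proof.
  intros Hab D P.
  destruct (MVT_cor2 g g' a b Hab) as [c [E Hc]].
  - intros c Hc. apply is_derive_Reals, D, Hc.
  - specialize (P c Hc). nra.
Qed.

Lemma sinh_pos x : 0 < x -> 0 < sinh x.
Proof. intros H. rewrite <- sinh_0. apply sinh_lt, H. Qed.

Lemma cosh_lt x y : 0 <= x -> x < y -> cosh x < cosh y.
Proof.
  intros H Hxy. apply (strict_increase cosh sinh); trivial.
  - intros z _. auto_derive; trivial; ring.
  - intros z Hz. apply sinh_pos; lra.
Qed.

Lemma sinh_scaled_lt a b d : 0 < a -> a < b -> 0 < d -> sinh (a * d) / a < sinh (b * d) / b.
Proof.
  intros Ha Hab Hd.
  assert (L : sinh (b * 0) / b - sinh (a * 0) / a < sinh (b * d) / b - sinh (a * d) / a).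
  { apply (strict_increase (fun x => sinh (b * x) / b - sinh (a * x) / a)
      (fun x => cosh (b * x) - cosh (a * x))); trivial.
    - intros x _. auto_derive; trivial. field. split; lra.
    - intros x Hx. assert (cosh (a * x) < cosh (b * x)); [|lra].
      apply cosh_lt; nra. }
  rewrite !Rmult_0_r, sinh_0 in L. unfold Rdiv in *. lra.
Qed.

Lemma tanh_lt x y : 0 < x -> x < y -> sinh x / cosh x < sinh y / cosh y.
Proof.
  intros Hx Hxy.
  assert (E : sinh (y - x) = sinh y * cosh x - cosh y * sinh x).
  { unfold sinh, cosh, Rminus. rewrite Ropp_plus_distr, !exp_plus, !Ropp_involutive. field. }
  assert (P : 0 < sinh (y - x)) by (apply sinh_pos; lra).
  pose proof (cosh_pos x); pose proof (cosh_pos y).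
  apply (Rmult_lt_reg_r (cosh x * cosh y)); [nra|].
  field_simplify; try lra.
Qed.

Lemma linear_profile_midpoint e a f m d : 0 < a -> 0 < d -> linear_profile e (a ^ 2) f ->
  exists p q, a ^ 2 * q ^ 2 + e = a ^ 2 * p ^ 2 /\
    p = (f (m + d) + f (m - d)) / 2 / cosh (a * d) /\
    q = (f (m + d) - f (m - d)) / 2 / sinh (a * d) /\
    forall s, f s = p * cosh (a * (s - m)) + q * sinh (a * (s - m)).
Proof.
  intros Ha Hd H. destruct (linear_profile_cosh e a f ltac:(lra) H m) as [p [q [E F]]].
  exists p, q. split; trivial.
  assert (P : 0 < sinh (a * d)) by (apply sinh_pos; nra).
  pose proof (cosh_pos (a * d)).
  rewrite (F (m + d)), (F (m - d)).
  replace (a * (m + d - m)) with (a * d) by ring.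
  replace (a * (m - d - m)) with (- (a * d)) by ring.
  rewrite cosh_neg, sinh_neg. repeat split; trivial; field; lra.
Qed.

(* With S = sinh (a d), C = cosh (a d), the relation [a^2 q^2 - 1 = a^2 p^2] becomes
   [D^2 = (S / a)^2 + M^2 (S / C)^2] for the half difference D and half sum M of
   the boundary values; the right-hand side increases with a. *)
Lemma sinh_profile_a_le a b f g m d : 0 < a -> 0 < b -> 0 < d ->
  linear_profile (-1) (a ^ 2) f -> linear_profile (-1) (b ^ 2) g ->
  f (m + d) = g (m + d) -> f (m - d) = g (m - d) -> ~ a < b.
Proof.
  intros Ha Hb Hd Hf Hg E1 E2 Hab.
  destruct (linear_profile_midpoint _ a f m d Ha Hd Hf) as [p [q [E [Hp [Hq _]]]]].
  destruct (linear_profile_midpoint _ b g m d Hb Hd Hg) as [p' [q' [E' [Hp' [Hq' _]]]]].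
  rewrite <- E1, <- E2 in Hp', Hq'.
  set (M := (f (m + d) + f (m - d)) / 2) in *. set (D := (f (m + d) - f (m - d)) / 2) in *.
  assert (key : forall c u v, 0 < c -> c ^ 2 * v ^ 2 + -1 = c ^ 2 * u ^ 2 ->
     u = M / cosh (c * d) -> v = D / sinh (c * d) ->
     D ^ 2 = (sinh (c * d) / c) ^ 2 + M ^ 2 * (sinh (c * d) / cosh (c * d)) ^ 2).
  { intros c u v Hc H Hu Hv.
    assert (P : 0 < sinh (c * d)) by (apply sinh_pos; nra). pose proof (cosh_pos (c * d)).
    transitivity ((sinh (c * d) / c) ^ 2 * (1 + c ^ 2 * u ^ 2)).
    - replace (1 + c ^ 2 * u ^ 2) with (c ^ 2 * v ^ 2) by lra. rewrite Hv. field. lra.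
    - rewrite Hu. field. lra. }
  pose proof (key a p q Ha E Hp Hq) as K1. pose proof (key b p' q' Hb E' Hp' Hq') as K2.
  pose proof (sinh_scaled_lt a b d Ha Hab Hd) as L1.
  assert (L2 : sinh (a * d) / cosh (a * d) < sinh (b * d) / cosh (b * d)) by (apply tanh_lt; nra).
  assert (P1 : 0 < sinh (a * d) / a) by (apply Rdiv_lt_0_compat; trivial; apply sinh_pos; nra).
  assert (P2 : 0 < sinh (a * d) / cosh (a * d))
    by (apply Rdiv_lt_0_compat; [apply sinh_pos; nra | apply cosh_pos]).
  set (x := sinh (a * d) / a) in *. set (y := sinh (b * d) / b) in *.
  set (z := sinh (a * d) / cosh (a * d)) in *. set (w := sinh (b * d) / cosh (b * d)) in *.
  assert (x ^ 2 < y ^ 2) by nra. assert (z ^ 2 <= w ^ 2) by nra.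
  assert (0 <= M ^ 2) by nra. nra.
Qed.

Lemma midpoint_split z1 z2 : z1 < z2 ->
  z1 = (z1 + z2) / 2 - (z2 - z1) / 2 /\ z2 = (z1 + z2) / 2 + (z2 - z1) / 2 /\ 0 < (z2 - z1) / 2.
Proof. lra. Qed.

Lemma linear_profile_unique e a f g z1 z2 : 0 < a -> z1 < z2 ->
  linear_profile e (a ^ 2) f -> linear_profile e (a ^ 2) g ->
  f z1 = g z1 -> f z2 = g z2 -> forall s, f s = g s.
Proof.
  intros Ha Hz Hf Hg E1 E2 s. destruct (midpoint_split z1 z2 Hz) as [X1 [X2 Hd]].
  set (m := (z1 + z2) / 2) in *. set (d := (z2 - z1) / 2) in *.
  rewrite X1 in E1. rewrite X2 in E2.
  destruct (linear_profile_midpoint _ a f m d Ha Hd Hf) as [p [q [_ [Hp [Hq F]]]]].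
  destruct (linear_profile_midpoint _ a g m d Ha Hd Hg) as [p' [q' [_ [Hp' [Hq' F']]]]].
  rewrite F, F'. rewrite E1, E2, <- Hp' in Hp. rewrite E1, E2, <- Hq' in Hq. rewrite Hp, Hq; reflexivity.
Qed.

Lemma sinh_profile_unique a b f g z1 z2 : 0 < a -> 0 < b -> z1 <> z2 ->
  linear_profile (-1) (a ^ 2) f -> linear_profile (-1) (b ^ 2) g ->
  f z1 = g z1 -> f z2 = g z2 -> f = g.
Proof.
  intros Ha Hb Hz Hf Hg E1 E2. apply functional_extensionality.
  assert (W : forall x1 x2, x1 < x2 -> f x1 = g x1 -> f x2 = g x2 -> forall s, f s = g s).
  { intros x1 x2 Hx F1 F2.
    assert (a = b).
    { destruct (midpoint_split x1 x2 Hx) as [X1 [X2 Hd]].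
      rewrite X1 in F1. rewrite X2 in F2.
      destruct (Rtotal_order a b) as [h|[h|h]]; trivial; exfalso; revert h.
      - eapply sinh_profile_a_le; eassumption.
      - eapply sinh_profile_a_le; try eassumption; symmetry; eassumption. }
    subst b. eapply linear_profile_unique; eassumption. }
  destruct (Rtotal_order z1 z2) as [h|[h|h]]; [|contradiction|].
  - apply (W z1 z2); trivial.
  - apply (W z2 z1); trivial.
Qed.

Section CoshCount.
Variables (d D : R).
Hypothesis d_pos : 0 < d.

Let phi (a : R) : R := (cosh (a * d) / a) ^ 2 + D ^ 2 / sinh (a * d) ^ 2.
Let phi' (a : R) : R :=
  2 * (cosh (a * d) / a) * ((d * sinh (a * d) * a - cosh (a * d)) / a ^ 2)
  - 2 * d * D ^ 2 * cosh (a * d) / sinh (a * d) ^ 3.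

Let S_pos a : 0 < a -> 0 < sinh (a * d).
Proof. intros; apply sinh_pos; nra. Qed.

Lemma phi_derive a : 0 < a -> is_derive phi a (phi' a).
Proof.
  intros Ha. pose proof (S_pos a Ha) as HS. unfold phi, phi'.
  auto_derive.
  - repeat split; nra.
  - field. lra.
Qed.

Lemma phi'_derive a : 0 < a -> exists l, 0 < l /\ is_derive phi' a l.
Proof.
  intros Ha. pose proof (S_pos a Ha) as HS.
  pose proof (cosh2 (a * d)) as C. pose proof (cosh_pos (a * d)) as HC.
  exists ((2 * (a * d) ^ 2 + 2 * cosh (a * d) ^ 2
      + 4 * (a * d * sinh (a * d) - cosh (a * d)) ^ 2) / a ^ 4
    + d ^ 2 * D ^ 2 * (6 + 4 * sinh (a * d) ^ 2) / sinh (a * d) ^ 4).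
  split.
  - apply Rplus_lt_le_0_compat.
    + apply Rdiv_lt_0_compat; [|apply pow_lt; trivial].
      pose proof (pow2_ge_0 (a * d)). pose proof (pow2_ge_0 (a * d * sinh (a * d) - cosh (a * d))).
      pose proof (pow2_gt_0 (cosh (a * d))). lra.
    + apply Rmult_le_pos; [|left; apply Rinv_0_lt_compat, pow_lt; trivial].
      pose proof (pow2_ge_0 (sinh (a * d))).
      apply Rmult_le_pos; [|lra]. apply Rmult_le_pos; apply pow2_ge_0.
  - unfold phi'. auto_derive.
    + repeat split; first [exact (pow_nonzero _ 3 (Rgt_not_eq _ _ HS)) | nra].
    + set (s := sinh (a * d)) in *. set (c := cosh (a * d)) in *.
      clearbody s c.
      apply (Rmult_eq_reg_r (a ^ 4 * s ^ 6)); [|apply Rmult_integral_contrapositive; split; apply pow_nonzero; lra].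
      field_simplify; try lra.
      apply (Rmult_eq_reg_r a); [|lra].
      unfold Rdiv. rewrite Rmult_assoc, Rinv_l, Rmult_1_r by lra. ring [C].
Qed.

Lemma cosh_count_aux a b c : 0 < a -> a < b -> b < c -> phi a = phi b -> phi b = phi c -> False.
Proof.
  intros Ha Hab Hbc E1 E2.
  destruct (MVT_cor2 phi phi' a b Hab) as [x [Ex Hx]];
    [intros y Hy; apply is_derive_Reals, phi_derive; lra|].
  destruct (MVT_cor2 phi phi' b c Hbc) as [y [Ey Hy]];
    [intros z Hz; apply is_derive_Reals, phi_derive; lra|].
  assert (Zx : phi' x = 0).
  { apply (Rmult_eq_reg_r (b - a)); lra. }
  assert (Zy : phi' y = 0).
  { apply (Rmult_eq_reg_r (c - b)); lra. }
  assert (L : phi' x < phi' y); [|lra].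
  apply (strict_increase phi' (Derive phi')); [lra| |]; intros z Hz;
    destruct (phi'_derive z ltac:(lra)) as [l [Hl Dl]].
  - rewrite (is_derive_unique phi' z l Dl). trivial.
  - rewrite (is_derive_unique phi' z l Dl). trivial.
Qed.
End CoshCount.

Lemma cosh_profile_count a1 a2 a3 f1 f2 f3 z1 z2 :
  0 < a1 -> 0 < a2 -> 0 < a3 -> z1 <> z2 ->
  linear_profile 1 (a1 ^ 2) f1 -> linear_profile 1 (a2 ^ 2) f2 -> linear_profile 1 (a3 ^ 2) f3 ->
  f1 z1 = f2 z1 -> f1 z2 = f2 z2 -> f1 z1 = f3 z1 -> f1 z2 = f3 z2 ->
  f1 = f2 \/ f1 = f3 \/ f2 = f3.
Proof.
  intros H1 H2 H3 Hz L1 L2 L3.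
  assert (W : forall z1 z2, z1 < z2 -> f1 z1 = f2 z1 -> f1 z2 = f2 z2 ->
     f1 z1 = f3 z1 -> f1 z2 = f3 z2 -> f1 = f2 \/ f1 = f3 \/ f2 = f3).
  { clear z1 z2 Hz. intros z1 z2 Hz E12 E12' E13 E13'.
    assert (Ha : a1 = a2 \/ a1 = a3 \/ a2 = a3).
    { apply NNPP. intros N. destruct (midpoint_split z1 z2 Hz) as [X1 [X2 Hd]].
      set (m := (z1 + z2) / 2) in *. set (d := (z2 - z1) / 2) in *.
      rewrite X1 in E12, E13. rewrite X2 in E12', E13'.
      set (M := (f1 (m + d) + f1 (m - d)) / 2). set (D := (f1 (m + d) - f1 (m - d)) / 2).
      assert (key : forall a f, 0 < a -> linear_profile 1 (a ^ 2) f ->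
         f1 (m - d) = f (m - d) -> f1 (m + d) = f (m + d) ->
         (cosh (a * d) / a) ^ 2 + D ^ 2 / sinh (a * d) ^ 2 = M ^ 2 - D ^ 2).
      { intros a f Ha Lf E E'.
        destruct (linear_profile_midpoint _ a f m d Ha Hd Lf) as [p [q [Eq [Hp [Hq _]]]]].
        rewrite <- E, <- E' in Hp, Hq. fold M in Hp. fold D in Hq.
        assert (P : 0 < sinh (a * d)) by (apply sinh_pos; nra).
        pose proof (cosh_pos (a * d)) as PC. pose proof (cosh2 (a * d)) as C.
        assert (HM : M ^ 2 = cosh (a * d) ^ 2 * (q ^ 2 + / a ^ 2)).
        { replace (q ^ 2 + / a ^ 2) with (p ^ 2).
          - rewrite Hp. field. lra.
          - apply (Rmult_eq_reg_l (a ^ 2)); [rewrite <- Eq; field; lra | apply pow_nonzero; lra]. }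
        rewrite HM, Hq, C. unfold Rdiv at 1. rewrite Rpow_mult_distr, C. field. lra. }
      pose proof (key a1 f1 H1 L1 eq_refl eq_refl) as K1.
      pose proof (key a2 f2 H2 L2 E12 E12') as K2.
      pose proof (key a3 f3 H3 L3 E13 E13') as K3.
      pose proof (cosh_count_aux d D Hd) as A.
      destruct (Rtotal_order a1 a2) as [h|[h|h]]; [|tauto|];
      (destruct (Rtotal_order a2 a3) as [h'|[h'|h']]; [|tauto|]);
      (destruct (Rtotal_order a1 a3) as [h''|[h''|h'']]; [|tauto|]); try lra.
      - apply (A a1 a2 a3); trivial; congruence.
      - apply (A a1 a3 a2); trivial; congruence.
      - apply (A a3 a1 a2); trivial; congruence.
      - apply (A a2 a1 a3); trivial; congruence.
      - apply (A a2 a3 a1); trivial; congruence.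
      - apply (A a3 a2 a1); trivial; congruence. }
    destruct Ha as [E|[E|E]]; subst; [left | right; left | right; right];
      apply functional_extensionality; (eapply (linear_profile_unique 1 _ _ _ z1 z2); [|exact Hz|eassumption|eassumption| |]); try eassumption; congruence. }
  intros. destruct (Rtotal_order z1 z2) as [h|[h|h]]; [|contradiction|].
  - apply (W z1 z2); trivial.
  - apply (W z2 z1); trivial.
Qed.

(** * Catenoids spanning two circles *)

Lemma generates_surface c k G phi f S : generates c k G phi f S -> S = surface k phi f.
Proof. intros [_ [_ H]]. apply pset_ext, H. Qed.

Lemma surface_in_frame k G phi phi' f' : k <> Par ->
  frame (axis_of k) G phi -> frame (axis_of k) G phi' ->
  exists f al eps o, (forall e K, linear_profile e K f' -> linear_profile e K f) /\
    surface k phi' f' = surface k phi f /\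
    forall s, phi' (profile k f' s) = phi (rot (axis_of k) al (profile k f (eps * s + o))).
Proof.
  intros Hk F F'. destruct (frame_change _ _ _ _ F F') as [Hi Hn]. pose proof F as [Hphi _].
  destruct (profile_change k _ Hk Hi Hn) as [al [eps [o [eta [He [Ht H]]]]]].
  exists (fun x => eta * f' (eps * (x - o))), al, eps, o. split; [|split].
  - intros e K. apply linear_profile_change; trivial.
  - apply (surface_change k G phi phi' _ _ al (fun s => eps * s + o)); trivial.
    + intros x. exists (eps * (x - o)). transitivity (eps ^ 2 * (x - o) + o); [ring|].
      rewrite He. ring.
  - intros s. rewrite <- H, inv_r by trivial. reflexivity.
Qed.

Definition cubic (f : R -> R) : Prop := exists a b, forall s, f s = a * s ^ 3 + b.

Lemma surface_in_frame_parabolic G phi phi' f' :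
  frame Parabolic G phi -> frame Parabolic G phi' -> cubic f' ->
  exists f, cubic f /\ surface Par phi' f' = surface Par phi f.
Proof.
  intros F F' [a [b Hf']]. destruct (frame_change _ _ _ _ F F') as [Hi Hn].
  destruct (profile_change_parabolic _ Hi Hn) as [al [lam [mu [Hl H]]]].
  exists (fun x => lam * f' (lam * x) + mu). split.
  - exists (a * lam ^ 4), (lam * b + mu). intros s. rewrite Hf'. ring.
  - apply (surface_change Par G phi phi' _ _ al (fun s => s / lam)); trivial.
    + intros x. exists (lam * x). field; trivial.
Qed.

Lemma cubic_unique f g z1 z2 : cubic f -> cubic g -> z1 <> z2 ->
  f z1 = g z1 -> f z2 = g z2 -> f = g.
Proof.
  intros [a [b Hf]] [a' [b' Hg]] Hz E1 E2. rewrite Hf, Hg in E1, E2.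
  assert (Hc : z1 ^ 3 - z2 ^ 3 <> 0).
  { intros E. apply Hz.
    assert (E' : (z1 - z2) * (z1 ^ 2 + z1 * z2 + z2 ^ 2) = 0) by (rewrite <- E; ring).
    apply Rmult_integral in E'. destruct E' as [E'|E']; [lra|].
    pose proof (pow2_ge_0 z1). pose proof (pow2_ge_0 z2). pose proof (pow2_ge_0 (z1 + z2)).
    assert (Z : (z1 - z2) * (z1 - z2) = 0) by lra.
    apply Rmult_integral in Z. lra. }
  assert (E : (a - a') * (z1 ^ 3 - z2 ^ 3) = 0) by lra.
  apply Rmult_integral in E. destruct E as [E|E]; [|contradiction].
  apply functional_extensionality. intros s. rewrite Hf, Hg.
  assert (a = a') by lra. subst. assert (b = b') by lra. subst. reflexivity.
Qed.

Lemma hyperbola_branch_eq r r' t t' :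
  r * cosh t = r' * cosh t' -> r * sinh t = r' * sinh t' -> r = r'.
Proof.
  intros Hc Hs. pose proof (cosh2 t) as C. pose proof (cosh2 t') as C'.
  pose proof (cosh_pos t). pose proof (cosh_pos t').
  assert (E : (r - r') * (r + r') = 0).
  { transitivity (r ^ 2 * (cosh t ^ 2 - sinh t ^ 2) - r' ^ 2 * (cosh t' ^ 2 - sinh t' ^ 2)).
    - rewrite C, C'. ring.
    - replace (r ^ 2 * (cosh t ^ 2 - sinh t ^ 2)) with ((r * cosh t) ^ 2 - (r * sinh t) ^ 2) by ring.
      rewrite Hc, Hs. ring. }
  apply Rmult_integral in E. destruct E as [E|E]; [lra|].
  assert (E' : r * (cosh t + cosh t') = 0) by (replace r' with (- r) in Hc by lra; lra).
  apply Rmult_integral in E'. lra.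
Qed.

Lemma orbit_profile_eq k f g t t' s s' : k <> Ell ->
  rot (axis_of k) t (profile k f s) = rot (axis_of k) t' (profile k g s') ->
  s = s' /\ f s = g s'.
Proof.
  intros Hk E. destruct k; try congruence; simpl in E.
  - injection E; intros E3 E2 E1. split; trivial.
    apply (hyperbola_branch_eq _ _ t t'); lra.
  - injection E; intros E3 E2 E1. split; trivial.
    apply (hyperbola_branch_eq _ _ t t'); lra.
  - injection E; intros E3 E2 E1.
    assert (Hs : s = s') by lra. split; trivial. subst s'.
    destruct (Req_dec s 0) as [->|Hs]; [lra|].
    assert (t = t') by (apply (Rmult_eq_reg_l s); lra). subst t'. lra.
Qed.

Lemma common_values k G phi C1 C2 : k <> Ell -> frame (axis_of k) G phi -> coaxial G C1 C2 ->
  exists z1 z2, z1 <> z2 /\ forall f g,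
    Defs.incl C1 (surface k phi f) -> Defs.incl C2 (surface k phi f) ->
    Defs.incl C1 (surface k phi g) -> Defs.incl C2 (surface k phi g) -> f z1 = g z1 /\ f z2 = g z2.
Proof.
  intros Hk F HC. pose proof HC as [H1 [H2 _]]. pose proof F as [Hi _].
  destruct (circle_in_frame _ _ _ _ F H1) as [q1 [Hq1 _]].
  destruct (circle_in_frame _ _ _ _ F H2) as [q2 [Hq2 _]].
  pose proof (coaxial_planes _ _ _ _ _ _ _ F HC Hq1 Hq2) as Hne.
  set (z := fun q => lor q (axis_dir (axis_of k)) / match k with Par => 2 | _ => 1 end).
  assert (Hz : forall f t s, z (rot (axis_of k) t (profile k f s)) = s).
  { intros f t s. unfold z. rewrite rot_axis_dir. coords. destruct k; try congruence; simpl; field. }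
  exists (z q1), (z q2). split.
  - unfold z. intros E. apply Hne. destruct k; lra.
  - assert (W : forall C q f g, C (phi q) -> Defs.incl C (surface k phi f) ->
      Defs.incl C (surface k phi g) -> f (z q) = g (z q)).
    { intros C q f g Hq If Ig. apply If in Hq as Sf. apply Ig in Hq as Sg.
      destruct Sf as [s [t Ef]], Sg as [s' [t' Eg]].
      apply isometry_inj in Ef, Eg; trivial. rewrite Ef in Eg.
      destruct (orbit_profile_eq k f g t t' s s' Hk Eg) as [<- E].
      rewrite Ef, Hz. trivial. }
    intros f g A1 A2 B1 B2. split; [apply (W C1) | apply (W C2)]; trivial.
Qed.

Lemma connects_in_frame c k G phi C1 C2 S : k <> Par -> frame (axis_of k) G phi ->
  connects c k G C1 C2 S ->
  exists f f', catenary c k f' /\ (forall e K, linear_profile e K f' -> linear_profile e K f) /\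
    S = surface k phi f /\ Defs.incl C1 (surface k phi f) /\ Defs.incl C2 (surface k phi f).
Proof.
  intros Hk F [[phi' [f' Hg]] [I1 I2]]. pose proof Hg as [F' [Hc _]].
  apply generates_surface in Hg. subst S.
  destruct (surface_in_frame k G phi phi' f' Hk F F') as [f [al [eps [o [L [E _]]]]]].
  rewrite E in I1, I2 |- *. exists f, f'. tauto.
Qed.

Lemma hyperbolic2_number G C1 C2 : coaxial G C1 C2 ->
  exists n, number (connects Timelike HypII G C1 C2) n /\ (n = 0 \/ n = 1)%nat.
Proof.
  intros HC. apply number_le_1. intros S S' H H'.
  pose proof H as [[phi [f0 [F _]]] _].
  destruct (common_values HypII G phi C1 C2 ltac:(discriminate) F HC) as [z1 [z2 [Hz Hv]]].
  destruct (connects_in_frame _ HypII _ phi _ _ _ ltac:(discriminate) F H) as [f [f' [Hf [Lf [-> [If1 If2]]]]]].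
  destruct (connects_in_frame _ HypII _ phi _ _ _ ltac:(discriminate) F H') as [g [g' [Hg [Lg [-> [Ig1 Ig2]]]]]].
  apply catenary_K_pos in Hf, Hg; [|tauto..].
  destruct Hf as [a [Ha Pf]], Hg as [b [Hb Pg]]. apply Lf in Pf. apply Lg in Pg.
  destruct (Hv f g If1 If2 Ig1 Ig2) as [E1 E2].
  rewrite (sinh_profile_unique a b f g z1 z2); trivial.
Qed.

Lemma hyperbolic1_number G C1 C2 : coaxial G C1 C2 ->
  exists n, number (connects Timelike HypI G C1 C2) n /\ (n = 0 \/ n = 1 \/ n = 2)%nat.
Proof.
  intros HC. apply number_le_2. intros S1 S2 S3 H1 H2 H3.
  pose proof H1 as [[phi [f0 [F _]]] _].
  destruct (common_values HypI G phi C1 C2 ltac:(discriminate) F HC) as [z1 [z2 [Hz Hv]]].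
  assert (W : forall S, connects Timelike HypI G C1 C2 S -> exists a f, 0 < a /\
     linear_profile 1 (a ^ 2) f /\ S = surface HypI phi f /\
     Defs.incl C1 (surface HypI phi f) /\ Defs.incl C2 (surface HypI phi f)).
  { intros S H.
    destruct (connects_in_frame _ HypI _ phi _ _ _ ltac:(discriminate) F H) as [f [f' [Hf [Lf Hr]]]].
    apply catenary_K_pos in Hf; [|tauto]. destruct Hf as [a [Ha Pf]]. exists a, f. split; trivial.
    split; trivial. apply Lf, Pf. }
  apply W in H1, H2, H3.
  destruct H1 as [a1 [f1 [P1 [L1 [-> [I1 J1]]]]]].
  destruct H2 as [a2 [f2 [P2 [L2 [-> [I2 J2]]]]]].
  destruct H3 as [a3 [f3 [P3 [L3 [-> [I3 J3]]]]]].
  destruct (Hv f1 f2 I1 J1 I2 J2) as [E1 E2]. destruct (Hv f1 f3 I1 J1 I3 J3) as [E3 E4].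
  destruct (cosh_profile_count a1 a2 a3 f1 f2 f3 z1 z2) as [E|[E|E]]; trivial; rewrite E; tauto.
Qed.

Lemma parabolic_number G C1 C2 : coaxial G C1 C2 ->
  exists n, number (fun S => exists c, connects c Par G C1 C2 S) n /\ (n = 0 \/ n = 1)%nat.
Proof.
  intros HC. apply number_le_1. intros S S' [c H] [c' H'].
  pose proof H as [[phi [f0 [F _]]] _].
  destruct (common_values Par G phi C1 C2 ltac:(discriminate) F HC) as [z1 [z2 [Hz Hv]]].
  assert (W : forall c S, connects c Par G C1 C2 S -> exists f, cubic f /\
     S = surface Par phi f /\ Defs.incl C1 (surface Par phi f) /\ Defs.incl C2 (surface Par phi f)).
  { intros c1 S1 [[phi' [f' Hg]] [I1 I2]]. pose proof Hg as [F' [Hc _]].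
    apply generates_surface in Hg. subst S1.
    destruct (surface_in_frame_parabolic G phi phi' f' F F') as [f [Cf E]].
    - apply (catenary_parabolic c1), Hc.
    - rewrite E in I1, I2 |- *. exists f. tauto. }
  apply W in H, H'.
  destruct H as [f [Cf [-> [I1 J1]]]]. destruct H' as [g [Cg [-> [I2 J2]]]].
  destruct (Hv f g I1 J1 I2 J2) as [E1 E2].
  rewrite (cubic_unique f g z1 z2); trivial.
Qed.

Lemma surface_elliptic_opp phi f eta : eta ^ 2 = 1 ->
  surface Ell phi (fun s => eta * f s) = surface Ell phi f.
Proof.
  assert (W : forall g, Defs.incl (surface Ell phi (fun s => -1 * g s)) (surface Ell phi g)).
  { intros g p [s [t ->]]. exists s, (t + PI). f_equal. simpl.
    rewrite neg_cos, neg_sin. pt; ring. }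
  intros H. assert (E : (eta - 1) * (eta + 1) = 0) by lra.
  apply Rmult_integral in E. destruct E as [E|E].
  - replace eta with 1 by lra. f_equal. apply functional_extensionality. intros; ring.
  - replace eta with (-1) by lra. apply pset_ext. intros p. split; [apply W|].
    intros Hp. apply W.
    replace (fun s => -1 * (-1 * f s)) with f; trivial.
    apply functional_extensionality. intros; ring.
Qed.

Lemma elliptic_number G C1 C2 p1 p2 : coaxial G C1 C2 -> C1 p1 -> C2 p2 ->
  exists n, number (connects_points Spacelike Ell G p1 p2) n /\ (n = 0 \/ n = 1)%nat.
Proof.
  intros HC Hp1 Hp2. apply number_le_1.
  intros S S' [phi [f [Hg [[z1 E1] [z2 E2]]]]] [phi' [g' [Hg' [[w1 E1'] [w2 E2']]]]].
  pose proof Hg as [F [Hf _]]. pose proof Hg' as [F' [Hf' _]].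
  apply generates_surface in Hg, Hg'. subst S S'.
  destruct (surface_in_frame Ell G phi phi' g' ltac:(discriminate) F F')
    as [g [al [eps [o [L [-> HP]]]]]].
  rewrite HP in E1', E2'.
  pose proof F as [Hi _].
  assert (Hz : z1 <> z2).
  { intros E. rewrite E1 in Hp1. rewrite E2 in Hp2.
    apply (coaxial_planes _ _ _ _ _ _ _ F HC Hp1 Hp2). coords. simpl. rewrite E. ring. }
  rewrite E1 in E1'. rewrite E2 in E2'.
  apply isometry_inj in E1', E2'; trivial. simpl in E1', E2'.
  injection E1' as X1 Y1 Z1. injection E2' as X2 Y2 Z2.
  rewrite <- Z1 in X1, Y1. rewrite <- Z2 in X2, Y2.
  apply catenary_K_pos in Hf, Hf'; [|tauto..].
  destruct Hf as [a [Ha Pf]], Hf' as [b [Hb Pg]]. apply L in Pg. simpl in Pf, Pg.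
  assert (Hval : exists eta, eta ^ 2 = 1 /\ f z1 = eta * g z1 /\ f z2 = eta * g z2).
  { destruct (Req_dec (sin al) 0) as [Hs|Hs].
    - exists (cos al). pose proof (sin2_cos2 al) as E. unfold Rsqr in E. rewrite Hs in E.
      repeat split; lra.
    - assert (G1 : g z1 * sin al = 0) by lra. assert (G2 : g z2 * sin al = 0) by lra.
      apply Rmult_integral in G1, G2.
      assert (g z1 = 0) as G1' by tauto. assert (g z2 = 0) as G2' by tauto.
      exists 1. rewrite X1, X2, G1', G2'. repeat split; ring. }
  destruct Hval as [eta [He [V1 V2]]].
  rewrite (sinh_profile_unique a b f (fun s => eta * g s) z1 z2); trivial.
  - apply surface_elliptic_opp; trivial.
  - replace (fun s => eta * g s) with (fun s => eta * g (1 * (s - 0))).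
    + apply linear_profile_change; trivial. ring.
    + apply functional_extensionality. intros s. do 2 f_equal. ring.
Qed.

(** * Branches of sine profiles *)

(* The phases [al < be] at the two circles of an arc of the sine curve
   [sin (a s + b) / a], where [rho] is the radius divided by the distance h; so [be - al = a h].
   [Sg] prescribes the ratio of the two signed radii. *)
Definition phases (Sg : R -> Prop) (rho al be : R) : Prop :=
  0 < al < PI /\ al < be /\ sin al = rho * (be - al) /\
  exists sg, Sg sg /\ sin be = sg * sin al.

(* [be = al + k PI] or [be = k PI - al]; for given k and rho each case is an
   equation for al with at most one solution on either side. The solutions with
   [al = PI / 2], which fall in both cases, are attributed to [Reflect]. *)
Inductive branch : Type := Translate (k : nat) (left : bool) | Reflect (k : nat) (left : bool).

Definition on_branch (rho : R) (j : branch) (al be : R) : Prop :=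
  match j with
  | Translate k true => be = al + INR k * PI /\ al < PI / 2
  | Translate k false => be = al + INR k * PI /\ PI / 2 < al
  | Reflect k true => be = INR k * PI - al /\ 0 <= cos al + 2 * rho
  | Reflect k false => be = INR k * PI - al /\ cos al + 2 * rho < 0
  end.

Definition index (j : branch) : nat := match j with Translate k _ | Reflect k _ => k end.

Lemma sin_k_PI k : sin (INR k * PI) = 0.
Proof. apply sin_eq_0_1. exists (Z.of_nat k). rewrite INR_IZR_INZ. reflexivity. Qed.

Lemma sin_eq_0_pos x : 0 < x -> sin x = 0 -> exists k, x = INR k * PI.
Proof.
  intros Hx H. destruct (sin_eq_0_0 x H) as [z Hz]. exists (Z.to_nat z).
  assert (H0 : 0 < IZR z) by (pose proof PI_RGT_0; nra).
  rewrite INR_IZR_INZ, Z2Nat.id; trivial. apply lt_IZR in H0. lia.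
Qed.

Lemma INR_PI_eq k k' : INR k * PI = INR k' * PI -> k = k'.
Proof. intros H. apply INR_eq. apply (Rmult_eq_reg_r PI); trivial. apply PI_neq0. Qed.

Lemma phases_branch Sg rho al be :
  (forall sg, Sg sg -> sg ^ 2 = 1) -> 0 < rho -> phases Sg rho al be ->
  exists j, on_branch rho j al be /\ INR (index j) < / (rho * PI) + 2.
Proof.
  intros HSg Hr [Ha [Hab [E [sg [Hsg E']]]]]. apply HSg in Hsg. pose proof PI_RGT_0 as HPI.
  assert (Hw : be - al <= / rho).
  { apply (Rmult_le_reg_l rho); trivial. rewrite <- E, Rinv_r by lra. apply SIN_bound. }
  assert (HB : (/ (rho * PI) + 2) * PI = / rho + 2 * PI) by (field; lra).
  assert (Z : sin (be - al) * sin (be + al) = 0).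
  { assert (C : forall x, cos x ^ 2 = 1 - sin x ^ 2)
      by (intros x; pose proof (sin2_cos2 x) as Q; unfold Rsqr in Q; lra).
    rewrite sin_minus, sin_plus.
    transitivity (sin be ^ 2 * cos al ^ 2 - cos be ^ 2 * sin al ^ 2); [ring|].
    rewrite !C, E'. replace ((sg * sin al) ^ 2) with (sg ^ 2 * sin al ^ 2) by ring.
    rewrite Hsg. ring. }
  apply Rmult_integral in Z.
  assert (Z' : sin (be + al) = 0 \/ (sin (be - al) = 0 /\ al <> PI / 2)).
  { destruct Z as [Z|Z]; [|tauto]. destruct (Req_dec al (PI / 2)) as [e|e]; [left|right; tauto].
    replace (be + al) with (be - al + PI) by lra. rewrite neg_sin. lra. }
  destruct Z' as [Z'|[Z' Hne]].
  - destruct (sin_eq_0_pos (be + al) ltac:(lra) Z') as [k Hk].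
    assert (INR k < / (rho * PI) + 2) by (apply (Rmult_lt_reg_r PI); trivial; lra).
    destruct (Rle_lt_dec 0 (cos al + 2 * rho)); [exists (Reflect k true) | exists (Reflect k false)];
      simpl; lra.
  - destruct (sin_eq_0_pos (be - al) ltac:(lra) Z') as [k Hk].
    assert (INR k < / (rho * PI) + 2) by (apply (Rmult_lt_reg_r PI); trivial; lra).
    destruct (Rlt_le_dec al (PI / 2)); [exists (Translate k true) | exists (Translate k false)];
      simpl; lra.
Qed.

Lemma branch_unique rho al be j j' : 0 < al < PI ->
  on_branch rho j al be -> on_branch rho j' al be -> j = j'.
Proof.
  intros Ha. pose proof PI_RGT_0.
  assert (X : forall k k', al <> PI / 2 -> al + INR k * PI = INR k' * PI - al -> False).
  { intros k k' N E.
    assert (E' : 2 * al = (INR k' - INR k) * PI) by lra.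
    rewrite !INR_IZR_INZ, <- minus_IZR in E'.
    assert (L : 0 < IZR (Z.of_nat k' - Z.of_nat k) < 2) by (split; nra).
    destruct L as [L1 L2]. apply lt_IZR in L1, L2.
    assert (Q : (Z.of_nat k' - Z.of_nat k = 1)%Z) by lia. rewrite Q in E'. lra. }
  assert (T : forall k k', be = al + INR k * PI -> be = al + INR k' * PI -> k = k')
    by (intros; apply INR_PI_eq; lra).
  assert (U : forall k k', be = INR k * PI - al -> be = INR k' * PI - al -> k = k')
    by (intros; apply INR_PI_eq; lra).
  destruct j as [k [|]|k [|]], j' as [k' [|]|k' [|]]; simpl; intros [E L] [E' L'];
    first [ lra | rewrite (T k k' E E'); reflexivity | rewrite (U k k' E E'); reflexivity
          | exfalso; apply (X k k'); lra | exfalso; apply (X k' k); lra ].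
Qed.

Lemma reflect_derivative (r x : R) k :
  is_derive (fun x => sin x - r * (INR k * PI - 2 * x)) x (cos x + 2 * r).
Proof. auto_derive; trivial. ring. Qed.

Lemma reflect_rolle r k x y : x < y -> exists c, x < c < y /\
  (sin y - r * (INR k * PI - 2 * y)) - (sin x - r * (INR k * PI - 2 * x))
  = (cos c + 2 * r) * (y - x).
Proof.
  intros Hxy.
  destruct (MVT_cor2 (fun x => sin x - r * (INR k * PI - 2 * x)) (fun x => cos x + 2 * r) x y Hxy)
    as [c [E Hc]].
  - intros c _. apply is_derive_Reals, reflect_derivative.
  - exists c. split; trivial.
Qed.

Lemma phases_inj Sg rho al be al' be' j :
  phases Sg rho al be -> phases Sg rho al' be' -> on_branch rho j al be -> on_branch rho j al' be' ->
  al = al' /\ be = be'.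
Proof.
  intros [Ha [Hab [E _]]] [Ha' [Hab' [E' _]]] B B'.
  (* On a reflection branch [sin x - rho (k PI - 2 x)] is strictly concave in x. *)
  assert (refl_lt : forall k x y, 0 < x -> x < y -> y < PI ->
     sin x = rho * (INR k * PI - 2 * x) -> sin y = rho * (INR k * PI - 2 * y) ->
     0 < cos x + 2 * rho /\ cos y + 2 * rho < 0).
  { intros k x y Hx Hxy Hy Ex Ey. destruct (reflect_rolle rho k x y Hxy) as [c [Hc D]].
    rewrite Ex, Ey in D.
    assert (Z : cos c + 2 * rho = 0) by (apply (Rmult_eq_reg_r (y - x)); lra).
    pose proof (cos_decreasing_1 x c ltac:(lra) ltac:(lra) ltac:(lra) ltac:(lra) ltac:(lra)).
    pose proof (cos_decreasing_1 c y ltac:(lra) ltac:(lra) ltac:(lra) ltac:(lra) ltac:(lra)). lra. }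
  assert (refl : forall k, be = INR k * PI - al -> be' = INR k * PI - al' ->
     (0 <= cos al + 2 * rho <-> 0 <= cos al' + 2 * rho) -> al = al').
  { intros k Hb Hb' Hs.
    assert (S1 : sin al = rho * (INR k * PI - 2 * al)) by (rewrite E, Hb; ring).
    assert (S2 : sin al' = rho * (INR k * PI - 2 * al')) by (rewrite E', Hb'; ring).
    destruct (Rtotal_order al al') as [h|[h|h]]; trivial; exfalso.
    - destruct (refl_lt k al al'); try tauto; lra.
    - destruct (refl_lt k al' al); try tauto; lra. }
  destruct j as [k [|]|k [|]]; simpl in B, B'.
  - assert (al = al') by (apply sin_inj; try lra; rewrite E, E'; f_equal; lra). lra.
  - assert (PI - al = PI - al')
      by (apply sin_inj; try lra; rewrite !sin_PI_x, E, E'; f_equal; lra). lra.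
  - assert (al = al') by (apply (refl k); tauto). lra.
  - assert (al = al') by (apply (refl k); try tauto; lra). lra.
Qed.

Lemma sin_lt_1 x : 0 < x < PI -> x <> PI / 2 -> sin x < 1.
Proof.
  intros Hx N. destruct (Rle_lt_or_eq_dec (sin x) 1 (proj2 (SIN_bound x))) as [|E]; trivial.
  exfalso. apply N. destruct (Rle_lt_dec x (PI / 2)) as [h|h].
  - apply sin_inj; try lra. rewrite sin_PI2. trivial.
  - enough (PI - x = PI / 2) by lra.
    apply sin_inj; try lra. rewrite sin_PI2, sin_PI_x. trivial.
Qed.

Lemma sin_solution y : 0 < y < 1 -> exists x, 0 < x < PI / 2 /\ sin x = y.
Proof.
  intros Hy. exists (asin y). pose proof (asin_bound_lt y ltac:(lra)). pose proof PI_RGT_0.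
  assert (S : sin (asin y) = y) by (apply sin_asin; lra). repeat split; trivial; try lra.
  apply Rnot_le_lt. intros L.
  assert (0 <= sin (- asin y)) by (apply sin_ge_0; lra). rewrite sin_neg in H1. lra.
Qed.

Lemma sin_translate k x : sin (x + INR k * PI) = cos (INR k * PI) * sin x.
Proof. rewrite sin_plus, sin_k_PI. ring. Qed.

Lemma sin_reflect k x : sin (INR k * PI - x) = - cos (INR k * PI) * sin x.
Proof. rewrite sin_minus, sin_k_PI. ring. Qed.

Lemma phases_continue Sg rho rho' al be j : 0 < rho' -> rho' <= rho ->
  phases Sg rho al be -> on_branch rho j al be ->
  exists al' be', phases Sg rho' al' be' /\ on_branch rho' j al' be'.
Proof.
  intros Hr Hrr [Ha [Hab [E [sg [Hsg E']]]]] B. pose proof PI_RGT_0 as HPI.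
  assert (Sa : 0 < sin al) by (apply sin_gt_0; lra).
  assert (T : forall k al', be = al + INR k * PI -> 0 < al' < PI -> sin al' = rho' * (INR k * PI) ->
     phases Sg rho' al' (al' + INR k * PI)).
  { intros k al' Hb Ha' S. split; [|split; [lra|split]]; trivial.
    - rewrite S. ring.
    - exists sg. split; trivial. rewrite Hb, sin_translate in E'.
      apply Rmult_eq_reg_r in E'; [|lra]. rewrite <- E'. apply sin_translate. }
  assert (U : forall k al', be = INR k * PI - al -> 0 < al' < PI -> al' < INR k * PI - al' ->
     sin al' = rho' * (INR k * PI - al' - al') -> phases Sg rho' al' (INR k * PI - al')).
  { intros k al' Hb Ha' Hk S. split; [|split; [|split]]; trivial.
    exists sg. split; trivial. rewrite Hb, sin_reflect in E'.
    apply Rmult_eq_reg_r in E'; [|lra]. rewrite <- E'. apply sin_reflect. }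
  assert (Q : forall k, 0 < INR k * PI -> rho * (INR k * PI) = sin al -> al <> PI / 2 ->
     exists x, 0 < x < PI / 2 /\ sin x = rho' * (INR k * PI)).
  { intros k Hk Ek N. apply sin_solution. pose proof (sin_lt_1 al Ha N). split; nra. }
  assert (IVTg : forall k x y, x <= y ->
     (sin x - rho' * (INR k * PI - 2 * x)) * (sin y - rho' * (INR k * PI - 2 * y)) <= 0 ->
     exists z, x <= z <= y /\ sin z = rho' * (INR k * PI - 2 * z)).
  { intros k x y Hxy Hs.
    destruct (IVT_cor (fun x => sin x - rho' * (INR k * PI - 2 * x)) x y) as [z [Hz Ez]]; trivial.
    - intros z. apply derivable_continuous_pt. exists (cos z + 2 * rho').
      apply is_derive_Reals, reflect_derivative.
    - exists z. split; trivial. lra. }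
  assert (G : forall k, be = INR k * PI - al -> 0 <= sin al - rho' * (INR k * PI - 2 * al)).
  { intros k Hb. rewrite E, Hb.
    replace (rho * (INR k * PI - al - al) - rho' * (INR k * PI - 2 * al))
      with ((rho - rho') * (INR k * PI - 2 * al)) by ring.
    apply Rmult_le_pos; lra. }
  destruct j as [k [|]|k [|]]; simpl in B; destruct B as [Hb Hs].
  - destruct (Q k) as [x [Hx Sx]]; try lra; [rewrite E, Hb; ring|].
    exists x, (x + INR k * PI). split; [apply T; trivial; lra|]. simpl. split; trivial; lra.
  - destruct (Q k) as [x [Hx Sx]]; try lra; [rewrite E, Hb; ring|].
    exists (PI - x), (PI - x + INR k * PI). split.
    + apply T; trivial; [lra|]. rewrite sin_PI_x. trivial.
    + simpl. split; trivial; lra.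
  - pose proof (G k Hb) as Gk.
    destruct (IVTg k 0 al) as [z [Hz Sz]]; [lra| |].
    { rewrite sin_0. assert (0 < rho' * (INR k * PI)) by (apply Rmult_lt_0_compat; lra). nra. }
    assert (z <> 0).
    { intros ->. rewrite sin_0 in Sz.
      assert (0 < rho' * (INR k * PI)) by (apply Rmult_lt_0_compat; lra). lra. }
    exists z, (INR k * PI - z). split; [apply U; trivial; try lra; rewrite Sz; ring|].
    simpl. split; trivial. apply Rnot_lt_le. intros N.
    destruct (Req_dec z al) as [->|Hne].
    + assert (Z : (rho - rho') * (be - al) = 0).
      { rewrite Hb. rewrite Hb, Sz in E. lra. }
      apply Rmult_integral in Z. lra.
    + destruct (reflect_rolle rho' k z al ltac:(lra)) as [c [Hc D]].
      pose proof (cos_decreasing_1 z c ltac:(lra) ltac:(lra) ltac:(lra) ltac:(lra) ltac:(lra)).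
      rewrite Sz in D. nra.
  - assert (K3 : 3 <= INR k).
    { destruct k as [|[|[|k]]]; [exfalso..|].
      - simpl in Hb. lra.
      - simpl in Hb. assert (0 < cos al) by (apply cos_gt_0; lra). nra.
      - replace (INR 2) with 2 in Hb by (simpl; ring).
        destruct (MVT_cor2 sin cos 0 (PI - al)) as [c [D Hc]]; [lra| |].
        { intros; apply derivable_pt_lim_sin. }
        rewrite sin_0, sin_PI_x, E, Hb in D.
        assert (Z : cos c = 2 * rho) by (apply (Rmult_eq_reg_r (PI - al)); lra).
        pose proof (cos_decreasing_1 c (PI - al) ltac:(lra) ltac:(lra) ltac:(lra) ltac:(lra) ltac:(lra)) as L.
        replace (PI - al) with (- al + PI) in L by ring. rewrite neg_cos, cos_neg in L. lra.
      - rewrite !S_INR. pose proof (pos_INR k). lra. }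
    pose proof (G k Hb) as Gk.
    assert (Pk : 0 < rho' * (INR k * PI - 2 * PI)) by (apply Rmult_lt_0_compat; trivial; nra).
    destruct (IVTg k al PI) as [z [Hz Sz]]; [lra| rewrite sin_PI; nra|].
    assert (z <> PI) by (intros ->; rewrite sin_PI in Sz; lra).
    exists z, (INR k * PI - z). split; [apply U; trivial; try nra|].
    simpl. split; trivial.
    destruct (Req_dec z al) as [->|Hne]; [lra|].
    pose proof (cos_decreasing_1 al z ltac:(lra) ltac:(lra) ltac:(lra) ltac:(lra) ltac:(lra)). lra.
Qed.

Definition realized (Sg : R -> Prop) (rho : R) (j : branch) : Prop :=
  exists al be, phases Sg rho al be /\ on_branch rho j al be.

Definition branch_eq_dec (j j' : branch) : {j = j'} + {j <> j'}.
Proof. repeat decide equality. Defined.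

Definition realized_list (Sg : R -> Prop) (rho : R) : list branch :=
  nodup branch_eq_dec
    (filter (fun j => if excluded_middle_informative (realized Sg rho j) then true else false)
      (flat_map (fun k => Translate k true :: Translate k false :: Reflect k true :: Reflect k false :: nil)
        (seq 0 (Z.to_nat (up (/ (rho * PI) + 2)))))).

Lemma in_realized_list Sg rho j : (forall sg, Sg sg -> sg ^ 2 = 1) -> 0 < rho ->
  (In j (realized_list Sg rho) <-> realized Sg rho j).
Proof.
  intros HSg Hr. unfold realized_list. rewrite nodup_In, filter_In.
  destruct (excluded_middle_informative (realized Sg rho j)) as [H|H]; [|intuition discriminate].
  split; [tauto|]. intros _. split; trivial. apply in_flat_map. exists (index j). split.
  - destruct H as [al [be [P B]]].
    destruct (phases_branch Sg rho al be HSg Hr P) as [j' [B' L]].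
    rewrite (branch_unique rho al be j j'); trivial; [|apply P].
    apply in_seq. split; [lia|]. simpl. apply INR_lt.
    set (B0 := / (rho * PI) + 2) in *. pose proof (pos_INR (index j')).
    assert (0 < IZR (up B0)) by (pose proof (archimed B0); lra).
    rewrite (INR_IZR_INZ (Z.to_nat _)), Z2Nat.id.
    + pose proof (archimed B0). lra.
    + apply lt_IZR in H0. lia.
  - destruct j as [k [|]|k [|]]; simpl; tauto.
Qed.

Lemma realized_list_mono Sg rho rho' : (forall sg, Sg sg -> sg ^ 2 = 1) -> 0 < rho' -> rho' <= rho ->
  (length (realized_list Sg rho) <= length (realized_list Sg rho'))%nat.
Proof.
  intros HSg Hr Hrr. apply NoDup_incl_length; [apply NoDup_nodup|].
  intros j. rewrite !in_realized_list by (trivial; lra).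
  intros [al [be [P B]]]. exact (phases_continue Sg rho rho' al be j Hr Hrr P B).
Qed.

Lemma realized_list_pos Sg rho : (forall sg, Sg sg -> sg ^ 2 = 1) -> 0 < rho ->
  Sg 1 \/ (Sg (-1) /\ 2 * rho < 1) -> (1 <= length (realized_list Sg rho))%nat.
Proof.
  intros HSg Hr H. pose proof PI_RGT_0 as HPI.
  assert (Hp : exists al be, phases Sg rho al be).
  { destruct H as [H|[H Hr2]].
    - destruct (IVT (fun x => sin x - rho * (PI - 2 * x)) 0 (PI / 2)) as [z [Hz Ez]].
      + intros z. apply derivable_continuous_pt. exists (cos z + 2 * rho).
        apply is_derive_Reals. auto_derive; trivial. ring.
      + lra.
      + rewrite sin_0. nra.
      + rewrite sin_PI2. lra.
      + assert (z <> 0) by (intros ->; rewrite sin_0 in Ez; nra).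
        assert (z <> PI / 2) by (intros ->; rewrite sin_PI2 in Ez; nra).
        exists z, (PI - z). repeat split; try lra. exists 1. split; trivial.
        rewrite sin_PI_x. ring.
    - assert (Hc : 0 < 2 * rho < 1) by lra. set (x0 := acos (2 * rho)).
      pose proof (acos_bound_lt (2 * rho) ltac:(lra)) as Hx0. fold x0 in Hx0.
      assert (Cx0 : cos x0 = 2 * rho) by (apply cos_acos; lra).
      destruct (MVT_cor2 sin cos 0 x0) as [c [D Hc']]; [lra| |].
      { intros; apply derivable_pt_lim_sin. }
      pose proof (cos_decreasing_1 c x0 ltac:(lra) ltac:(lra) ltac:(lra) ltac:(lra) ltac:(lra)) as L.
      rewrite sin_0 in D.
      destruct (IVT (fun x => 2 * rho * x - sin x) x0 PI) as [z [Hz Ez]].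
      + intros z. apply derivable_continuous_pt. exists (2 * rho - cos z).
        apply is_derive_Reals. auto_derive; trivial. ring.
      + lra.
      + nra.
      + rewrite sin_PI. nra.
      + assert (z <> PI) by (intros ->; rewrite sin_PI in Ez; nra).
        exists (PI - z), (PI + z). repeat split; try lra.
        * rewrite sin_PI_x. lra.
        * exists (-1). split; trivial. rewrite sin_PI_x, Rplus_comm, neg_sin. ring. }
  destruct Hp as [al [be P]]. destruct (phases_branch Sg rho al be HSg Hr P) as [j [B _]].
  assert (I : In j (realized_list Sg rho))
    by (apply in_realized_list; trivial; exists al, be; tauto).
  destruct (realized_list Sg rho); [destruct I|simpl; lia].
Qed.

Lemma cos_k_PI_parity sg : sg ^ 2 = 1 ->
  exists c, forall i, (c <= 2)%nat /\ (0 < c)%nat /\ cos (INR (2 * i + c) * PI) = sg.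
Proof.
  intros H. assert (E : (sg - 1) * (sg + 1) = 0) by lra. apply Rmult_integral in E.
  destruct E as [E|E].
  - exists 2%nat. intros i. repeat split; try lia.
    replace (INR (2 * i + 2) * PI) with (0 + 2 * INR (i + 1) * PI)
      by (rewrite !plus_INR, mult_INR; simpl; ring).
    rewrite cos_period, cos_0. lra.
  - exists 1%nat. intros i. repeat split; try lia.
    replace (INR (2 * i + 1) * PI) with (PI + 2 * INR i * PI)
      by (rewrite plus_INR, mult_INR; simpl; ring).
    rewrite cos_period, cos_PI. lra.
Qed.

Lemma realized_list_unbounded Sg rho sg M : (forall sg, Sg sg -> sg ^ 2 = 1) -> Sg sg ->
  0 < rho -> rho * (INR (2 * M + 2) * PI) < 1 -> (M <= length (realized_list Sg rho))%nat.
Proof.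
  intros HSg H Hr HM. pose proof PI_RGT_0 as HPI.
  destruct (cos_k_PI_parity sg (HSg sg H)) as [c Hc].
  rewrite <- (length_seq M 0), <- (length_map (fun i => Translate (2 * i + c) true)).
  apply NoDup_incl_length.
  - apply NoDup_map_NoDup_ForallPairs; [|apply seq_NoDup].
    intros i i' _ _ E. injection E. lia.
  - intros j Hj. apply in_map_iff in Hj. destruct Hj as [i [<- Hi]]. apply in_seq in Hi.
    apply in_realized_list; trivial. destruct (Hc i) as [C2 [C0 C]].
    assert (K : 0 < INR (2 * i + c)) by (apply lt_0_INR; lia).
    assert (K' : INR (2 * i + c) <= INR (2 * M + 2)) by (apply le_INR; lia).
    destruct (sin_solution (rho * (INR (2 * i + c) * PI))) as [x [Hx Sx]].
    { split; [apply Rmult_lt_0_compat; nra|]. apply Rle_lt_trans with (2 := HM).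
      apply Rmult_le_compat_l; nra. }
    exists x, (x + INR (2 * i + c) * PI). split.
    + split; [lra|split; [nra|split]].
      * rewrite Sx. ring.
      * exists sg. split; trivial. rewrite sin_translate, C. reflexivity.
    + split; [reflexivity|lra].
Qed.

Lemma number_of_relation {J : Type} (l : list J) (A : pset -> Prop) (Rel : J -> pset -> Prop) :
  NoDup l -> (forall j, In j l -> exists S, Rel j S) ->
  (forall S, A S <-> exists j, In j l /\ Rel j S) ->
  (forall j S S', Rel j S -> Rel j S' -> S = S') ->
  (forall j j' S, Rel j S -> Rel j' S -> j = j') -> number A (length l).
Proof.
  intros Hl Hex HA Hf Hi.
  set (g := fun j => epsilon (inhabits (fun _ : point => True)) (Rel j)).
  assert (Hg : forall j, In j l -> Rel j (g j))
    by (intros j Hj; apply epsilon_spec, Hex, Hj).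
  exists (map g l). split; [|split].
  - apply NoDup_map_NoDup_ForallPairs; trivial. intros x y Hx Hy E.
    apply Hg in Hx, Hy. rewrite E in Hx. apply (Hi x y (g y)); trivial.
  - apply length_map.
  - intros S. rewrite in_map_iff, HA. split.
    + intros [j [<- Hj]]. exists j. auto.
    + intros [j [Hj HR]]. exists j. split; trivial. apply (Hf j); auto.
Qed.

(** * Counting sine profiles *)

(* The sine profile with phases al at m1 and be at m2, and initial sign eta. *)
Definition arc (eta m1 m2 al be s : R) : R :=
  eta * (sin (al + (be - al) * ((s - m1) / (m2 - m1))) * (Rabs (m1 - m2) / (be - al))).

Lemma arc_left eta m1 m2 al be r : m1 <> m2 -> al < be ->
  sin al = r / Rabs (m1 - m2) * (be - al) -> arc eta m1 m2 al be m1 = eta * r.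
Proof.
  intros Hm Hab E. unfold arc.
  assert (0 < Rabs (m1 - m2)) by (apply Rabs_pos_lt; lra).
  replace (al + (be - al) * ((m1 - m1) / (m2 - m1))) with al by (field; lra).
  rewrite E. field. lra.
Qed.

Lemma arc_right eta m1 m2 al be : m1 <> m2 ->
  arc eta m1 m2 al be m2 = eta * (sin be * (Rabs (m1 - m2) / (be - al))).
Proof.
  intros Hm. unfold arc. do 3 f_equal. field. lra.
Qed.

Lemma arc_catenary c k eta m1 m2 al be : m1 <> m2 -> al < be -> eta ^ 2 = 1 ->
  (c, k) = (Timelike, Ell) \/ (c, k) = (Spacelike, HypII) ->
  catenary c k (arc eta m1 m2 al be).
Proof.
  intros Hm Hab He Hck. set (a := (be - al) / (m2 - m1)).
  assert (Ha : a <> 0).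
  { unfold a, Rdiv. apply Rmult_integral_contrapositive. split; [lra|]. apply Rinv_neq_0_compat. lra. }
  assert (Hs : eta * (Rabs (m1 - m2) / (m2 - m1)) = 1 \/ eta * (Rabs (m1 - m2) / (m2 - m1)) = -1).
  { assert (E : (eta - 1) * (eta + 1) = 0) by lra. apply Rmult_integral in E.
    assert (X : Rabs (m1 - m2) / (m2 - m1) = 1 \/ Rabs (m1 - m2) / (m2 - m1) = -1).
    { unfold Rabs. destruct (Rcase_abs (m1 - m2)); [left|right]; field; lra. }
    destruct E as [E|E], X as [X|X]; rewrite X; lra. }
  assert (F : exists b, arc eta m1 m2 al be = (fun s => sin (a * s + b) / a)).
  { destruct Hs as [Hs|Hs].
    - exists (al - a * m1). apply functional_extensionality. intros s. unfold arc.
      replace (a * s + (al - a * m1)) with (al + (be - al) * ((s - m1) / (m2 - m1)))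
        by (unfold a; field; lra).
      set (y := sin _). transitivity (eta * (Rabs (m1 - m2) / (m2 - m1)) * (y / a)).
      + unfold a. field. split; lra.
      + rewrite Hs. ring.
    - exists (al - a * m1 + PI). apply functional_extensionality. intros s. unfold arc.
      replace (a * s + (al - a * m1 + PI)) with (al + (be - al) * ((s - m1) / (m2 - m1)) + PI)
        by (unfold a; field; lra). rewrite neg_sin.
      set (y := sin _). transitivity (eta * (Rabs (m1 - m2) / (m2 - m1)) * (y / a)).
      + unfold a. field. split; lra.
      + rewrite Hs. field. trivial. }
  destruct F as [b ->]. apply catenary_sin; trivial.
Qed.

Lemma arc_surj Sg eta m1 m2 r a f sg : m1 <> m2 -> eta ^ 2 = 1 -> 0 < r -> 0 < a ->
  linear_profile (-1) (- a ^ 2) f -> f m1 = eta * r -> Sg sg -> f m2 = sg * f m1 ->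
  exists al be, phases Sg (r / Rabs (m1 - m2)) al be /\ f = arc eta m1 m2 al be.
Proof.
  intros Hm He Hr Ha Hf E1 Hsg E2.
  set (h := Rabs (m1 - m2)). assert (Hh : 0 < h) by (apply Rabs_pos_lt; lra).
  set (eps := (m2 - m1) / h).
  assert (Heps : eps ^ 2 = 1).
  { unfold eps. replace (((m2 - m1) / h) ^ 2) with ((m1 - m2) ^ 2 / h ^ 2) by (field; lra).
    unfold h. rewrite pow2_abs. field. lra. }
  destruct (linear_profile_cos _ a f ltac:(lra) Hf m1) as [p [q [E F]]].
  assert (Hp : p = eta * r).
  { rewrite <- E1, F. replace (a * (m1 - m1)) with 0 by ring. rewrite cos_0, sin_0. ring. }
  set (x := a * eta * q * eps).
  assert (Hx : x ^ 2 = 1 - (a * r) ^ 2).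
  { unfold x. replace ((a * eta * q * eps) ^ 2) with (a ^ 2 * q ^ 2 * eta ^ 2 * eps ^ 2) by ring.
    rewrite He, Heps. rewrite Hp in E.
    replace ((eta * r) ^ 2) with (eta ^ 2 * r ^ 2) in E by ring. rewrite He in E. lra. }
  assert (Har : 0 < a * r) by (apply Rmult_lt_0_compat; trivial).
  assert (Hx1 : -1 < x < 1) by (split; nra).
  set (al := acos x).
  assert (Ca : cos al = x) by (apply cos_acos; lra).
  assert (Ba : 0 < al < PI) by (apply acos_bound_lt; trivial).
  assert (Sa : sin al = a * r).
  { pose proof (sin2_cos2 al) as T. rewrite Ca in T. unfold Rsqr in T.
    pose proof (sin_gt_0 al ltac:(lra) ltac:(lra)). nra. }
  set (be := al + a * h).
  assert (Hw : be - al = a * h) by (unfold be; ring).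
  assert (Hah : 0 < a * h) by (apply Rmult_lt_0_compat; trivial).
  assert (Ff : f = arc eta m1 m2 al be).
  { apply functional_extensionality. intros s. unfold arc. fold h. rewrite Hw.
    replace (a * h * ((s - m1) / (m2 - m1))) with (eps * (a * (s - m1))).
    2: { transitivity (eps ^ 2 * (a * h * ((s - m1) / (m2 - m1)))); [unfold eps; field; lra|].
         rewrite Heps. ring. }
    assert (Ev : cos (eps * (a * (s - m1))) = cos (a * (s - m1)) /\
                 sin (eps * (a * (s - m1))) = eps * sin (a * (s - m1))).
    { assert (Z : (eps - 1) * (eps + 1) = 0) by lra. apply Rmult_integral in Z.
      destruct Z as [Z|Z].
      - replace eps with 1 by lra. rewrite !Rmult_1_l. split; trivial.
      - replace eps with (-1) by lra.
        replace (-1 * (a * (s - m1))) with (- (a * (s - m1))) by ring.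
        rewrite cos_neg, sin_neg. split; ring. }
    destruct Ev as [Ev1 Ev2]. rewrite sin_plus, Ev1, Ev2, Sa, Ca, F, Hp. unfold x.
    set (C := cos _). set (S := sin _).
    transitivity (eta * r * C + eta ^ 2 * eps ^ 2 * q * S); [rewrite He, Heps; ring|field; lra]. }
  exists al, be. split; trivial. repeat split; try lra.
  - rewrite Hw, Sa. field. lra.
  - exists sg. split; trivial.
    assert (M1 : arc eta m1 m2 al be m1 = eta * r) by (rewrite <- Ff; trivial).
    rewrite E1, Ff, arc_right in E2 by trivial. fold h in E2. rewrite Hw in E2.
    apply (Rmult_eq_reg_l (eta * / a)).
    + rewrite Sa. transitivity (eta * (sin be * (h / (a * h)))); [field; lra|].
      rewrite E2. field. lra.
    + apply Rmult_integral_contrapositive. split; [|apply Rinv_neq_0_compat; lra].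
      intros Z. rewrite Z in He. lra.
Qed.

Lemma arc_inj Sg rho eta m1 m2 al be al' be' : m1 <> m2 -> eta ^ 2 = 1 ->
  phases Sg rho al be -> phases Sg rho al' be' ->
  (forall s, arc eta m1 m2 al be s ^ 2 = arc eta m1 m2 al' be' s ^ 2) -> al = al' /\ be = be'.
Proof.
  intros Hm He [Ha [Hab [E _]]] [Ha' [Hab' [E' _]]] H.
  set (h := Rabs (m1 - m2)) in *. assert (Hh : 0 < h) by (apply Rabs_pos_lt; lra).
  set (w := be - al) in *. set (w' := be' - al') in *.
  assert (Hw : 0 < w) by (unfold w; lra). assert (Hw' : 0 < w') by (unfold w'; lra).
  assert (K : forall x, sin (al + w * x) ^ 2 / w ^ 2 = sin (al' + w' * x) ^ 2 / w' ^ 2).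
  { intros x. specialize (H (m1 + x * (m2 - m1))). unfold arc in H. fold h w w' in H.
    replace ((m1 + x * (m2 - m1) - m1) / (m2 - m1)) with x in H by (field; lra).
    apply (Rmult_eq_reg_l (eta ^ 2 * h ^ 2)).
    - transitivity ((eta * (sin (al + w * x) * (h / w))) ^ 2); [field; lra|].
      rewrite H. field. lra.
    - rewrite He. nra. }
  assert (W : forall a b v u, 0 < v -> 0 < u ->
      (forall x, sin (a + v * x) ^ 2 / v ^ 2 = sin (b + u * x) ^ 2 / u ^ 2) -> u <= v).
  { intros a b v u Hv Hu Hx. specialize (Hx ((PI / 2 - a) / v)).
    replace (a + v * ((PI / 2 - a) / v)) with (PI / 2) in Hx by (field; lra).
    rewrite sin_PI2 in Hx. pose proof (SIN_bound (b + u * ((PI / 2 - a) / v))) as B.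
    set (y := sin (b + u * ((PI / 2 - a) / v))) in *.
    assert (Y : u ^ 2 = y ^ 2 * v ^ 2).
    { transitivity (1 ^ 2 / v ^ 2 * (u ^ 2 * v ^ 2)); [field; lra|]. rewrite Hx. field. lra. }
    assert (y ^ 2 <= 1) by nra. apply Rsqr_incr_0_var; [|lra]. unfold Rsqr. nra. }
  assert (Ew : w = w').
  { apply Rle_antisym; [apply (W al' al w' w) | apply (W al al' w w')]; trivial.
    intros x. symmetry. apply K. }
  assert (Es : sin al = sin al') by (rewrite E, E', Ew; reflexivity).
  assert (Ea : al = al').
  { (* At [w x = PI / 4] the equality of squares separates al from [PI - al]. *)
    specialize (K (PI / 4 / w)). rewrite <- Ew in K.
    replace (w * (PI / 4 / w)) with (PI / 4) in K by (field; lra).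
    assert (K' : sin (al + PI / 4) ^ 2 = sin (al' + PI / 4) ^ 2).
    { apply (Rmult_eq_reg_r (/ w ^ 2)); [exact K|].
      apply Rinv_neq_0_compat, pow_nonzero. lra. }
    rewrite !sin_plus, sin_PI4, cos_PI4, Es in K'.
    assert (S0 : 0 < sin al') by (apply sin_gt_0; lra).
    set (c := 1 / sqrt 2) in *.
    assert (Hc : 0 < c) by (apply Rdiv_lt_0_compat; [lra | apply sqrt_lt_R0; lra]).
    pose proof (sin2_cos2 al) as T. pose proof (sin2_cos2 al') as T'. unfold Rsqr in T, T'.
    rewrite Es in T.
    assert (Z : 2 * c ^ 2 * sin al' * (cos al - cos al') = 0).
    { assert (T2 : cos al ^ 2 = cos al' ^ 2) by lra.
      transitivity ((sin al' * c + cos al * c) ^ 2 - (sin al' * c + cos al' * c) ^ 2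
         - c ^ 2 * (cos al ^ 2 - cos al' ^ 2)); [ring|]. rewrite K', T2. ring. }
    apply Rmult_integral in Z. destruct Z as [Z|Z].
    - assert (0 < c ^ 2) by nra. nra.
    - apply cos_inj; lra. }
  split; trivial. unfold w, w' in Ew. lra.
Qed.

Lemma arc_number c k G phi eta m1 m2 r Sg (A : pset -> Prop) :
  (forall sg, Sg sg -> sg ^ 2 = 1) -> m1 <> m2 -> eta ^ 2 = 1 -> 0 < r ->
  (c, k) = (Timelike, Ell) \/ (c, k) = (Spacelike, HypII) ->
  frame (axis_of k) G phi ->
  (forall f g, surface k phi f = surface k phi g -> forall s, f s ^ 2 = g s ^ 2) ->
  (forall S, A S <-> exists f, S = surface k phi f /\ catenoid c k G S /\
     (exists a, 0 < a /\ linear_profile (-1) (- a ^ 2) f) /\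
     f m1 = eta * r /\ exists sg, Sg sg /\ f m2 = sg * f m1) ->
  number A (length (realized_list Sg (r / Rabs (m1 - m2)))).
Proof.
  intros HSg Hm He Hr Hck F Hinj HA.
  assert (Hh : 0 < Rabs (m1 - m2)) by (apply Rabs_pos_lt; lra).
  set (rho := r / Rabs (m1 - m2)) in *.
  assert (Hrho : 0 < rho) by (apply Rdiv_lt_0_compat; trivial).
  apply (number_of_relation _ A (fun j S => exists al be,
    phases Sg rho al be /\ on_branch rho j al be /\ S = surface k phi (arc eta m1 m2 al be))).
  - apply NoDup_nodup.
  - intros j Hj. apply in_realized_list in Hj; trivial. destruct Hj as [al [be [P B]]].
    exists (surface k phi (arc eta m1 m2 al be)), al, be. auto.
  - intros S. rewrite HA. split.
    + intros [f [-> [_ [[a [Ha L]] [E1 [sg [Hsg E2]]]]]]].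
      destruct (arc_surj Sg eta m1 m2 r a f sg) as [al [be [P Ef]]]; trivial. fold rho in P.
      destruct (phases_branch Sg rho al be HSg Hrho P) as [j [B _]].
      exists j. split; [apply in_realized_list; trivial; exists al, be; auto|].
      exists al, be. rewrite Ef. auto.
    + intros [j [_ [al [be [P [_ ->]]]]]]. exists (arc eta m1 m2 al be). split; trivial.
      destruct P as [P1 [P2 [P3 [sg [Hsg P4]]]]].
      pose proof (arc_catenary c k eta m1 m2 al be Hm P2 He Hck) as Hcat.
      split; [|split; [|split]].
      * exists phi, (arc eta m1 m2 al be). split; [|split]; trivial. intros p. reflexivity.
      * apply (catenary_K_neg c k); trivial.
      * apply arc_left; trivial.
      * exists sg. split; trivial. rewrite arc_right, P4 by trivial.
        rewrite (arc_left eta m1 m2 al be r) by trivial. rewrite P3. unfold rho. field. lra.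
  - intros j S S' [al [be [P [B ->]]]] [al' [be' [P' [B' ->]]]].
    destruct (phases_inj Sg rho al be al' be' j) as [-> ->]; trivial.
  - intros j j' S [al [be [P [B ->]]]] [al' [be' [P' [B' E]]]].
    destruct (arc_inj Sg rho eta m1 m2 al be al' be') as [<- <-]; trivial.
    + apply Hinj, E.
    + apply (branch_unique rho al be); trivial. apply P.
Qed.

Lemma elliptic_surface_sq phi f x y z : isometry phi ->
  surface Ell phi f (phi (x, y, z)) -> x ^ 2 + y ^ 2 = f z ^ 2.
Proof.
  intros Hi [s [t E]]. apply isometry_inj in E; trivial. simpl in E.
  injection E as -> -> <-. pose proof (sin2_cos2 t) as T. unfold Rsqr in T.
  transitivity (f z ^ 2 * (sin t * sin t + cos t * cos t)); [ring|rewrite T; ring].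
Qed.

Lemma profile_in_surface k phi f s : surface k phi f (phi (profile k f s)).
Proof. exists s, 0. rewrite rot_0. reflexivity. Qed.

Lemma elliptic_surface_inj phi f g : isometry phi ->
  surface Ell phi f = surface Ell phi g -> forall s, f s ^ 2 = g s ^ 2.
Proof.
  intros Hi E s. pose proof (profile_in_surface Ell phi f s) as P. rewrite E in P.
  apply elliptic_surface_sq in P; trivial. lra.
Qed.

Lemma ecircle_incl phi f r m : isometry phi ->
  (Defs.incl (image phi (ecircle r m)) (surface Ell phi f) <-> f m ^ 2 = r ^ 2).
Proof.
  intros Hi. split.
  - intros H.
    assert (P : surface Ell phi f (phi (r * cos 0, r * sin 0, m))).
    { apply H. exists (r * cos 0, r * sin 0, m). split; trivial. exists 0. trivial. }
    apply elliptic_surface_sq in P; trivial. rewrite cos_0, sin_0 in P. lra.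
  - intros E.
    assert (He : exists eta, eta ^ 2 = 1 /\ eta * f m = r).
    { assert (Z : (f m - r) * (f m + r) = 0) by lra. apply Rmult_integral in Z.
      destruct Z; [exists 1 | exists (-1)]; lra. }
    destruct He as [eta [He Er]]. rewrite <- (surface_elliptic_opp phi f eta He).
    intros p [q [[t ->] ->]]. exists m, t. f_equal. simpl. rewrite Er. pt; ring.
Qed.

Lemma hyperbolic2_surface_value phi f x y t : isometry phi ->
  surface HypII phi f (phi (x, y * sinh t, y * cosh t)) -> f x = y.
Proof.
  intros Hi [s [t' E]]. apply isometry_inj in E; trivial. simpl in E.
  injection E as <- E1 E2. symmetry. apply (hyperbola_branch_eq _ _ t t'); lra.
Qed.

Lemma hyperbolic2_surface_inj phi f g : isometry phi ->
  surface HypII phi f = surface HypII phi g -> forall s, f s = g s.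
Proof.
  intros Hi E s. symmetry. apply (hyperbolic2_surface_value phi g s (f s) 0); trivial.
  rewrite <- E, sinh_0, cosh_0.
  replace (s, f s * 0, f s * 1) with (profile HypII f s) by (simpl; pt; ring).
  apply profile_in_surface.
Qed.

Lemma hyperbola2_incl phi f c m : isometry phi ->
  (Defs.incl (image phi (hyperbola2 c m)) (surface HypII phi f) <-> f m = c).
Proof.
  intros Hi. split.
  - intros H. apply (hyperbolic2_surface_value phi f m c 0); trivial.
    apply H. exists (m, c * sinh 0, c * cosh 0). split; trivial. exists 0. trivial.
  - intros <- p [q [[t ->] ->]]. exists m, t. f_equal. simpl. pt; ring.
Qed.

Lemma linear_profile_scale e K f eta : eta ^ 2 = 1 ->
  linear_profile e K f -> linear_profile e K (fun s => eta * f s).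
Proof.
  intros He H. replace (fun s => eta * f s) with (fun s => eta * f (1 * (s - 0))).
  - apply linear_profile_change; trivial. ring.
  - apply functional_extensionality. intros s. do 2 f_equal. ring.
Qed.

Lemma timelike_elliptic_number G phi r m1 m2 : 0 < r -> frame Elliptic G phi -> m1 <> m2 ->
  number (connects Timelike Ell G (image phi (ecircle r m1)) (image phi (ecircle r m2)))
    (length (realized_list (fun sg => sg ^ 2 = 1) (r / Rabs (m1 - m2)))).
Proof.
  intros Hr F Hm. pose proof F as [Hi _].
  apply (arc_number Timelike Ell G phi 1); trivial; try tauto; try ring.
  - intros f g. apply elliptic_surface_inj; trivial.
  - intros S. split.
    + intros H. pose proof H as [HS _].
      destruct (connects_in_frame _ Ell _ phi _ _ _ ltac:(discriminate) F H)
        as [f [f' [Hf [Lf [E [I1 I2]]]]]].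
      apply ecircle_incl in I1, I2; trivial.
      apply catenary_K_neg in Hf; [|tauto]. destruct Hf as [a [Ha Pf]]. apply Lf in Pf.
      assert (He : exists eta, eta ^ 2 = 1 /\ eta * f m1 = r).
      { assert (Z : (f m1 - r) * (f m1 + r) = 0) by lra. apply Rmult_integral in Z.
        destruct Z; [exists 1 | exists (-1)]; lra. }
      destruct He as [eta [He Er]]. exists (fun s => eta * f s).
      split; [rewrite surface_elliptic_opp; trivial|]. split; trivial. split; [|split].
      * exists a. split; trivial. apply linear_profile_scale; trivial.
      * lra.
      * exists (eta * f m2 / r). split; [|rewrite Er; field; lra].
        replace ((eta * f m2 / r) ^ 2) with (eta ^ 2 * f m2 ^ 2 / r ^ 2) by (field; lra).
        rewrite He, I2. field. lra.
    + intros [f [-> [Hc [_ [E1 [sg [Hsg E2]]]]]]]. split; trivial.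
      rewrite !ecircle_incl by trivial. rewrite E2, Rpow_mult_distr, Hsg, E1. split; ring.
Qed.

Lemma spacelike_hyperbolic2_number G phi c1 c2 m1 m2 : c1 <> 0 -> Rabs c1 = Rabs c2 ->
  frame Hyperbolic G phi -> m1 <> m2 ->
  number (connects Spacelike HypII G (image phi (hyperbola2 c1 m1)) (image phi (hyperbola2 c2 m2)))
    (length (realized_list (fun sg => c2 = sg * c1) (Rabs c1 / Rabs (m1 - m2)))).
Proof.
  intros Hc1 Hc F Hm. pose proof F as [Hi _].
  assert (Hr : 0 < Rabs c1) by (apply Rabs_pos_lt; trivial).
  assert (Hs : exists eta, eta ^ 2 = 1 /\ c1 = eta * Rabs c1).
  { unfold Rabs. destruct (Rcase_abs c1); [exists (-1) | exists 1]; lra. }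
  destruct Hs as [eta [He Ec]].
  apply (arc_number Spacelike HypII G phi eta); trivial; try tauto.
  - intros sg E. assert (E2 : c2 ^ 2 = c1 ^ 2) by (rewrite <- (pow2_abs c1), <- (pow2_abs c2), Hc; trivial).
    rewrite E in E2. apply (Rmult_eq_reg_r (c1 ^ 2)); [lra|]. apply pow_nonzero; trivial.
  - intros f g E s. rewrite (hyperbolic2_surface_inj phi f g); trivial.
  - intros S. rewrite <- Ec. split.
    + intros H. pose proof H as [HS _].
      destruct (connects_in_frame _ HypII _ phi _ _ _ ltac:(discriminate) F H)
        as [f [f' [Hf [Lf [E [I1 I2]]]]]].
      apply hyperbola2_incl in I1, I2; trivial.
      apply catenary_K_neg in Hf; [|tauto]. destruct Hf as [a [Ha Pf]]. apply Lf in Pf.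
      exists f. split; [trivial|]. split; [trivial|]. split; [exists a; tauto|]. split; [trivial|].
      exists (c2 / c1). rewrite I1, I2. split; field; trivial.
    + intros [f [-> [Hcat [_ [E1 [sg [Hsg E2]]]]]]]. split; trivial.
      rewrite !hyperbola2_incl by trivial. split; trivial. rewrite E2, E1, Hsg. reflexivity.
Qed.

Lemma realized_list_lim Sg sg r : (forall sg, Sg sg -> sg ^ 2 = 1) -> Sg sg -> 0 < r ->
  is_lim (fun h => INR (length (realized_list Sg (r / h)))) p_infty p_infty.
Proof.
  intros HSg H Hr. apply is_lim_spec. intros M. simpl.
  set (n := Z.to_nat (up (Rmax M 0))).
  assert (Hn : M < INR n).
  { unfold n. pose proof (archimed (Rmax M 0)) as [A _]. pose proof (Rmax_l M 0). pose proof (Rmax_r M 0).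
    rewrite INR_IZR_INZ, Z2Nat.id; [lra|]. apply le_IZR. lra. }
  exists (r * (INR (2 * n + 2) * PI)). intros h Hh. apply Rlt_le_trans with (1 := Hn).
  apply le_INR. pose proof PI_RGT_0.
  assert (0 < INR (2 * n + 2)) by (apply lt_0_INR; lia).
  assert (0 < r * (INR (2 * n + 2) * PI)) by (apply Rmult_lt_0_compat; [|apply Rmult_lt_0_compat]; lra).
  apply (realized_list_unbounded Sg _ sg); trivial.
  - apply Rdiv_lt_0_compat; lra.
  - apply (Rmult_lt_reg_r h); [lra|]. unfold Rdiv.
    replace (r * / h * (INR (2 * n + 2) * PI) * h) with (r * (INR (2 * n + 2) * PI)) by (field; lra).
    lra.
Qed.

Lemma realized_list_mono_distance Sg r h h' : (forall sg, Sg sg -> sg ^ 2 = 1) -> 0 < r ->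
  0 < h -> h <= h' ->
  (length (realized_list Sg (r / h)) <= length (realized_list Sg (r / h')))%nat.
Proof.
  intros HSg Hr Hh Hhh. apply realized_list_mono; trivial.
  - apply Rdiv_lt_0_compat; lra.
  - apply Rmult_le_compat_l; [lra|]. apply Rinv_le_contravar; trivial.
Qed.

Theorem theorem1p1 :
  (forall (G : (point -> point) -> Prop) (C1 C2 : pset),
     rotation_group G -> coaxial G C1 C2 ->
     (forall p1 p2, C1 p1 -> C2 p2 ->
        exists n, number (connects_points Spacelike Ell G p1 p2) n /\
                  (n = 0 \/ n = 1)%nat) /\
     (exists n, number (connects Timelike HypII G C1 C2) n /\ (n = 0 \/ n = 1)%nat) /\
     (exists n, number (fun S => exists c, connects c Par G C1 C2 S) n /\
                (n = 0 \/ n = 1)%nat) /\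
     (exists n, number (connects Timelike HypI G C1 C2) n /\
                (n = 0 \/ n = 1 \/ n = 2)%nat)) /\
  (forall r : R, 0 < r ->
     exists N : R -> nat,
       (forall G phi m1 m2, frame Elliptic G phi -> m1 <> m2 ->
          number (connects Timelike Ell G
                    (image phi (ecircle r m1)) (image phi (ecircle r m2)))
                 (N (Rabs (m1 - m2)))) /\
       (forall h, 0 < h -> (1 <= N h)%nat) /\
       (forall h h', 0 < h -> h <= h' -> (N h <= N h')%nat) /\
       is_lim (fun h => INR (N h)) p_infty p_infty) /\
  (forall c1 c2 : R, c1 <> 0 -> Rabs c1 = Rabs c2 ->
     exists N : R -> nat,
       (forall G phi m1 m2, frame Hyperbolic G phi -> m1 <> m2 ->
          number (connects Spacelike HypII G
                    (image phi (hyperbola2 c1 m1)) (image phi (hyperbola2 c2 m2)))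
                 (N (Rabs (m1 - m2)))) /\
       (forall h, 0 < h -> c1 = c2 \/ 2 * Rabs c1 < h -> (1 <= N h)%nat) /\
       (forall h h', 0 < h -> h <= h' -> (N h <= N h')%nat) /\
       is_lim (fun h => INR (N h)) p_infty p_infty).
Proof.
  split; [|split].
  - intros G C1 C2 _ HC. split; [|split; [|split]].
    + intros p1 p2. apply elliptic_number; trivial.
    + apply hyperbolic2_number; trivial.
    + apply parabolic_number; trivial.
    + apply hyperbolic1_number; trivial.
  - intros r Hr.
    exists (fun h => length (realized_list (fun sg => sg ^ 2 = 1) (r / h))).
    split; [|split; [|split]].
    + intros G phi m1 m2. apply timelike_elliptic_number; trivial.
    + intros h Hh. apply realized_list_pos; trivial.
      * apply Rdiv_lt_0_compat; trivial.
      * left. ring.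
    + intros h h'. apply realized_list_mono_distance; trivial.
    + apply (realized_list_lim _ 1); trivial. ring.
  - intros c1 c2 Hc1 Hc.
    assert (Hr : 0 < Rabs c1) by (apply Rabs_pos_lt; trivial).
    assert (E2 : c2 ^ 2 = c1 ^ 2) by (rewrite <- (pow2_abs c1), <- (pow2_abs c2), Hc; trivial).
    assert (HSg : forall sg, c2 = sg * c1 -> sg ^ 2 = 1).
    { intros sg E. rewrite E in E2. apply (Rmult_eq_reg_r (c1 ^ 2)); [lra|]. apply pow_nonzero; trivial. }
    exists (fun h => length (realized_list (fun sg => c2 = sg * c1) (Rabs c1 / h))).
    split; [|split; [|split]].
    + intros G phi m1 m2. apply spacelike_hyperbolic2_number; trivial.
    + intros h Hh Hch. apply realized_list_pos; trivial.
      * apply Rdiv_lt_0_compat; trivial.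
      * assert (Z : (c2 - c1) * (c2 + c1) = 0) by lra. apply Rmult_integral in Z.
        destruct Z as [Z|Z]; [left; lra|].
        destruct Hch as [Hch|Hch]; [left; lra|right]. split; [lra|].
        apply (Rmult_lt_reg_r h); trivial.
        replace (2 * (Rabs c1 / h) * h) with (2 * Rabs c1) by (field; lra). lra.
    + intros h h'. apply realized_list_mono_distance; trivial.
    + apply (realized_list_lim _ (c2 / c1)); trivial. field; trivial.
Qed.
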